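(* Let $S=\{\lambda_j\}_{j=1}^\infty$ be a set of distinct real numbers, and let $\{\theta_j\}_{j=1}^\infty\subset[0,\pi)$ be a set of angles (not necessarily distinct). If $h:[0,\infty)\to(0,\infty)$ is a positive function with $\lim_{x\to\infty}h(x)=\infty$, then there exist real-valued $C^\infty$ potentials $p,q\in L^2[0,\infty)$ satisfying $$\sqrt{p(x)^2+q(x)^2}\le\frac{h(x)}{1+x}\qquad\text{for all }x\ge 0,$$ such that for each $j=1,2,\dots$ the equation $$L_{p,q}\begin{pmatrix}u\\ v\end{pmatrix}=\lambda_j\begin{pmatrix}u\\ v\end{pmatrix}$$ has a nontrivial solution $(u_j,v_j)^T\in L^2[0,\infty)\bigoplus L^2[0,\infty)$ satisfying the boundary condition $$\frac{u_j(0)}{v_j(0)}=\cot\theta_j .$$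
   Context: For real-valued functions $p,q\in L^2[0,\infty)$ (called potentials), the Dirac operator in canonical form is $$L_{p,q}\begin{pmatrix}u\\ v\end{pmatrix}=\begin{pmatrix}0&-1\\1&0\end{pmatrix}\frac{d}{dx}\begin{pmatrix}u\\ v\end{pmatrix}+\begin{pmatrix}-p&q\\ q&p\end{pmatrix}\begin{pmatrix}u\\ v\end{pmatrix}$$ on $[0,\infty)$. The potential is called $C^\infty$ if both $p$ and $q$ are $C^\infty$ on $[0,\infty)$. The boundary condition $\frac{u(0)}{v(0)}=\cot\theta_j$ means $u(0)\sin\theta_j-v(0)\cos\theta_j=0$; in particular for $\theta_j=0$ it means $v(0)=0$. *)

(* Defs.v *)
From mathcomp Require Import all_boot all_order all_algebra.
From mathcomp Require Import all_classical all_reals all_analysis.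

Set Implicit Arguments.
Unset Strict Implicit.
Unset Printing Implicit Defensive.

Import Order.TTheory GRing.Theory Num.Theory.
Import numFieldNormedType.Exports.

Local Open Scope classical_set_scope.
Local Open Scope ring_scope.

(* A function on [0, +oo) is represented by a total function R -> R; every
   notion below depends only on its values on [0, +oo). *)

(* The limit is taken within [0, +oo), so at x = 0 it is the right derivative;
   for x > 0 it is the ordinary (two-sided) derivative.  As for the library's
   [derive1], the value is meaningful only under [hl_derivable f x]. *)
Definition hl_quotient (R : realType) (f : R -> R) (x : R) : set_system R :=
  (f y - f x) / (y - x) @[y --> within `[0, +oo[ x^'].

Definition hl_derivable (R : realType) (f : R -> R) (x : R) : Prop :=
  cvg (hl_quotient f x).

Definition hl_derive (R : realType) (f : R -> R) (x : R) : R :=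
  lim (hl_quotient f x).

Definition hl_smooth (R : realType) (f : R -> R) : Prop :=
  forall (n : nat) (x : R), 0 <= x -> hl_derivable (iter n (@hl_derive R) f) x.

Definition hl_L2 (R : realType) (f : R -> R) : Prop :=
  f \_ `[0, +oo[ \in Lfun (@lebesgue_measure R) 2%:E.

Definition vec2 (R : realType) (a b : R) : 'cV[R]_2 :=
  \col_i (if i == 0 then a else b).

Definition mat2 (R : realType) (a b c d : R) : 'M[R]_2 :=
  \matrix_(i, j) (if i == 0 then if j == 0 then a else b
                  else if j == 0 then c else d).

(* The Dirac operator L_{p,q} in canonical form. *)
Definition dirac_op (R : realType) (p q u v : R -> R) (x : R) : 'cV[R]_2 :=
  mat2 0 (-1) 1 0 *m vec2 (hl_derive u x) (hl_derive v x)
  + mat2 (- p x) (q x) (q x) (p x) *m vec2 (u x) (v x).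

(* Classical solutions on [0, +oo).  For continuous p and q these are exactly
   the locally absolutely continuous (a.e.) solutions. *)
Definition dirac_solution (R : realType) (p q : R -> R) (lam : R)
    (u v : R -> R) : Prop :=
  forall x : R, 0 <= x ->
    [/\ hl_derivable u x, hl_derivable v x
      & dirac_op p q u v x = lam *: vec2 (u x) (v x)].

Definition hl_nontrivial (R : realType) (u v : R -> R) : Prop :=
  exists2 x : R, 0 <= x & vec2 (u x) (v x) != 0.

(* u(0) / v(0) = cot theta, in the form that covers theta = 0 (v(0) = 0). *)
Definition boundary_cond (R : realType) (theta : R) (u v : R -> R) : Prop :=
  u 0 * sin theta - v 0 * cos theta = 0.

(* Main.v *)
Require Import Defs.
From mathcomp Require Import all_boot all_order all_algebra.
From mathcomp Require Import all_classical all_reals all_analysis.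
From mathcomp Require Import measurable_realfun zify ring lra.
Import Order.TTheory GRing.Theory Num.Theory.
Import numFieldNormedType.Exports.
Local Open Scope classical_set_scope.
Local Open Scope ring_scope.

Set Implicit Arguments.
Unset Strict Implicit.
Unset Printing Implicit Defensive.

(** Write z = u + i v and W = q + i p.  The equation L_{p,q}(u, v) = lam (u, v)
    says z' = - i lam z - W conj(z), so y = exp(i lam x) z, which has the same
    modulus as z, solves y' = - W exp(2 i lam x) conj(y).

    Take for W a single pulse a(x) exp(- 2 i lambda_t x + i omega) with a a
    smooth bump.  For lam = lambda_t the coefficient of conj(y) has the constant
    phase omega; if omega is twice the phase of y at the start of the pulse,
    then y keeps its phase and y' = - a y, so |y| decays by the factor
    exp(- integral of a).  For lam = lambda_j with j <> t the coefficient
    oscillates with frequency 2 (lambda_j - lambda_t), and an averaging argument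
    ([off_resonance_bound]) shows that |y|^2 at most doubles, whatever the total
    mass of a, as soon as a is small compared with |lambda_j - lambda_t| and
    varies slowly.

    The potential consists of one pulse on each dyadic block [2^k, 2^(k+1)], of
    height about M_k / 2^k, where M_k tends to infinity as slowly as h and the
    square integrability of W require ([slow_heights]).  While x doubles, the
    pulse divides the squared modulus of the solution that it is tuned to by
    exp(2 M_k).  Block k is tuned to lambda_t with t the 2-adic valuation of
    k + 1, so that each j is served once in any 2^(j+1) consecutive blocks
    ([ruler_window]).  Since M_k tends to infinity while that period stays
    fixed, the gain of one visit eventually outweighs the doublings of the whole
    period by any prescribed factor, and |z_j(2^k)|^2 = O(4^(-k)), which makes z_j
    square integrable ([dyadic_decay], [decay_of_dyadic]).  A pulse whose height is not small
    compared with the gaps |lambda_i - lambda_t|, i < t, is left out; for each j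
    this affects only finitely many blocks ([schedule]).

    The phase of the k-th pulse depends on the solution at 2^k, hence on the
    earlier pulses, so pulses and solutions are constructed together by
    recursion on k ([pulse_sequence]).  The solutions out of resonance have no
    closed form; they come from Picard iteration ([linear_ode]).  In the rotating
    frame a solution is constant where the pulse vanishes, so the global
    solutions, like the potentials, are locally finite sums over the blocks
    ([pulse_train]). *)

(** * Derivatives of explicit real functions *)

(** The rules of differentiation for explicit abstractions, rather than for the
    pointwise ring operations on functions. *)
Lemma is_deriveDf (R : realType) (f g : R -> R) (x a b : R) :
  is_derive x 1 f a -> is_derive x 1 g b ->
  is_derive x 1 (fun y => f y + g y) (a + b).
Proof. by move=> fa gb; apply: is_deriveD. Qed.

Lemma is_deriveBf (R : realType) (f g : R -> R) (x a b : R) :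
  is_derive x 1 f a -> is_derive x 1 g b ->
  is_derive x 1 (fun y => f y - g y) (a - b).
Proof. by move=> fa gb; apply: is_deriveB. Qed.

Lemma is_deriveNf (R : realType) (f : R -> R) (x a : R) :
  is_derive x 1 f a -> is_derive x 1 (fun y => - f y) (- a).
Proof. by move=> fa; apply: is_deriveN. Qed.

Lemma is_deriveMf (R : realType) (f g : R -> R) (x a b : R) :
  is_derive x 1 f a -> is_derive x 1 g b ->
  is_derive x 1 (fun y => f y * g y) (a * g x + f x * b).
Proof.
move=> fa gb; rewrite addrC [a * _]mulrC.
exact: (@is_deriveM R R f g x 1 a b).
Qed.

Lemma is_derive_compf (R : realType) (f g : R -> R) (x a b : R) :
  is_derive (g x) 1 f a -> is_derive x 1 g b ->
  is_derive x 1 (fun y => f (g y)) (a * b).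
Proof. by move=> fa gb; apply: is_derive1_comp. Qed.

Lemma is_deriveVf (R : realType) (f : R -> R) (x a : R) :
  f x != 0 -> is_derive x 1 f a ->
  is_derive x 1 (fun y => (f y)^-1) (- a / f x ^+ 2).
Proof.
move=> fx fa; have := @is_deriveV R f x a 1 fx fa.
by rewrite [_ *: _]mulrC mulrN mulNr.
Qed.

Lemma is_derive_ext (R : realType) (f g : R -> R) (x a : R) :
  f =1 g -> is_derive x 1 f a -> is_derive x 1 g a.
Proof. by move=> /funext ->. Qed.

Lemma is_derive_val (R : realType) (f : R -> R) (x a b : R) :
  is_derive x 1 f a -> a = b -> is_derive x 1 f b.
Proof. by move=> fa <-. Qed.

Lemma is_derive_continuous (R : realType) (f : R -> R) (x a : R) :
  is_derive x 1 f a -> {for x, continuous f}.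
Proof. by case=> /derivable1_diffP/differentiable_continuous. Qed.

Lemma is_derive_lin (R : realType) (a b x : R) :
  is_derive x 1 (fun y => a * y + b) a.
Proof.
have := is_deriveDf (is_deriveMf (is_derive_cst a x 1) (is_derive_id x 1))
  (is_derive_cst b x 1).
by rewrite mul0r mulr1 add0r addr0.
Qed.

Lemma ler_of_derive (R : realType) (f g f' g' : R -> R) (a b : R) : a <= b ->
  f a <= g a ->
  (forall x, a <= x -> x <= b -> is_derive x 1 f (f' x)) ->
  (forall x, a <= x -> x <= b -> is_derive x 1 g (g' x)) ->
  (forall x, a <= x -> x <= b -> f' x <= g' x) -> f b <= g b.
Proof.
move=> ab fga df dg fg'.
pose d y := g y - f y; pose d' y := g' y - f' y.
have dd y : a <= y -> y <= b -> is_derive y 1 d (d' y).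
  by move=> ay yb; apply: is_deriveBf; [exact: dg|exact: df].
have [||c cin] := @MVT_segment R d d' a b ab.
- by move=> y; rewrite in_itv/= => /andP[/ltW ay /ltW yb]; exact: dd.
- apply: continuous_in_subspaceT => y.
  rewrite inE/= in_itv/= => /andP[ay yb]; apply: is_derive_continuous.
  exact: dd.
move=> e; rewrite -subr_ge0.
have -> : g b - f b = (d b - d a) + (g a - f a) by rewrite /d; ring.
rewrite e addr_ge0 ?subr_ge0// mulr_ge0 ?subr_ge0//.
by move: cin; rewrite in_itv/= => /andP[? ?]; exact: fg'.
Qed.

Lemma derive0_eq (R : realType) (f : R -> R) (a b : R) : a <= b ->
  (forall x, a <= x -> x <= b -> is_derive x 1 f 0) -> f a = f b.
Proof.
move=> ab df.
have [||c _] := @MVT_segment R f (cst 0) a b ab.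
- by move=> y; rewrite in_itv/= => /andP[/ltW ay /ltW yb]; exact: df.
- apply: continuous_in_subspaceT => y.
  rewrite inE/= in_itv/= => /andP[ay yb]; apply: is_derive_continuous.
  exact: df.
by rewrite mul0r => /eqP; rewrite subr_eq0 eq_sym => /eqP.
Qed.

(** * Smooth functions *)

(** Order 0 imposes nothing, not even continuity: each closure property is then
    a plain induction on the order, and only functions of class [Ck n] for all
    [n] matter in the end. *)
Fixpoint Ck (R : realType) (n : nat) (f : R -> R) : Prop :=
  if n is m.+1 then
    exists2 f' : R -> R, (forall x : R, is_derive x 1 f (f' x)) & @Ck R m f'
  else True.

Definition smooth (R : realType) (f : R -> R) := forall n, Ck n f.

Lemma CkS (R : realType) n (f : R -> R) : Ck n.+1 f -> Ck n f.
Proof.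
elim: n f => [//|n IH] f [f' df f'n].
by exists f' => //; apply: IH.
Qed.

Lemma Ck_cst (R : realType) n (c : R) : Ck n (fun=> c).
Proof.
elim: n c => [//|n IH] c /=; exists (fun=> 0) => // x.
exact: is_derive_cst.
Qed.

Lemma Ck_add (R : realType) n (f g : R -> R) : Ck n f -> Ck n g ->
  Ck n (fun x => f x + g x).
Proof.
elim: n f g => [//|n IH] f g [f' df fn] [g' dg gn].
exists (fun x => f' x + g' x); last exact: IH.
by move=> x; apply: is_deriveDf.
Qed.

Lemma Ck_mul (R : realType) n (f g : R -> R) : Ck n f -> Ck n g ->
  Ck n (fun x => f x * g x).
Proof.
elim: n f g => [//|n IH] f g fS gS.
have [f' df fn] := fS; have [g' dg gn] := gS.
exists (fun x => f' x * g x + f x * g' x).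
  by move=> x; apply: is_deriveMf.
by apply: Ck_add; apply: IH => //; exact: CkS.
Qed.

Lemma Ck_comp (R : realType) n (f g : R -> R) : Ck n f -> Ck n g ->
  Ck n (fun x => f (g x)).
Proof.
elim: n f g => [//|n IH] f g [f' df fn] gS.
have [g' dg gn] := gS.
exists (fun x => f' (g x) * g' x).
  by move=> x; apply: is_derive_compf.
by apply: Ck_mul => //; apply: IH => //; exact: CkS.
Qed.

Lemma Ck_inv (R : realType) n (f : R -> R) : (forall x, f x != 0) ->
  Ck n f -> Ck n (fun x => (f x)^-1).
Proof.
move=> f0; elim: n => [//|n IH] fS; have [f' df fn] := fS.
exists (fun x => - 1 * f' x * ((f x)^-1 * (f x)^-1)).
  move=> x; have := is_deriveVf (f0 x) (df x).
  by rewrite mulN1r -invfM -expr2.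
have fi : Ck n (fun x => (f x)^-1) by apply: IH; exact: CkS.
apply: Ck_mul; last exact: Ck_mul.
by apply: Ck_mul => //; exact: (Ck_cst n (-1)).
Qed.

Lemma Ck_lin (R : realType) n (a b : R) : Ck n (fun x => a * x + b).
Proof.
case: n => [//|n]; exists (fun=> a); last exact: Ck_cst.
by move=> x; exact: is_derive_lin.
Qed.

Lemma Ck_sin_cos (R : realType) n : Ck n (@sin R) /\ Ck n (@cos R).
Proof.
elim: n => [//|n [IHs IHc]]; split.
  by exists cos => // x; exact: is_derive_sin.
exists (fun x => - 1 * sin x); first by move=> x; rewrite mulN1r; exact: is_derive_cos.
by apply: Ck_mul => //; exact: (Ck_cst n (-1)).
Qed.

Lemma smooth_deriv (R : realType) (f f' : R -> R) : smooth f ->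
  (forall x : R, is_derive x 1 f (f' x)) -> smooth f'.
Proof.
move=> fs df n; have [g dg gn] := fs n.+1.
suff -> : f' = g by [].
by apply/funext => x; rewrite -(@derive_val _ _ _ _ _ _ _ (df x)) derive_val.
Qed.

Lemma smooth_ex_deriv (R : realType) (f : R -> R) : smooth f ->
  exists2 f', (forall x : R, is_derive x 1 f (f' x)) & smooth f'.
Proof.
move=> fs; have [f' df _] := fs 1%N; exists f' => //.
exact: (smooth_deriv fs).
Qed.

Lemma smooth_continuous (R : realType) (f : R -> R) :
  smooth f -> continuous f.
Proof. by case/smooth_ex_deriv => f' df _ x; apply: is_derive_continuous. Qed.

Lemma smooth_sum (R : realType) (f : nat -> R -> R) n :
  (forall k, smooth (f k)) -> smooth (fun x => \sum_(k < n) f k x).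
Proof.
move=> fs m; elim: n => [|n IH].
  by under eq_fun do rewrite big_ord0; exact: Ck_cst.
by under eq_fun do rewrite big_ord_recr; apply: Ck_add => //; exact: fs.
Qed.

Lemma within_halfline_proper (R : realType) (x : R) : 0 <= x ->
  ProperFilter (within `[0, +oo[ x^').
Proof.
move=> x0; apply: Build_ProperFilter_ex => P.
rewrite /within/= => -[e /= e0 eP]; exists (x + e / 2).
apply: eP => /=.
- by rewrite opprD addNKr normrN gtr0_norm ?divr_gt0// ltr_pdivrMr// ltr_pMr// ltr1n.
- by rewrite gt_eqF// ltrDl divr_gt0.
- by rewrite in_itv/= andbT addr_ge0// divr_ge0// ltW.
Qed.

Lemma hl_quotient_cvg (R : realType) (f g : R -> R) (x l : R) : 0 <= x ->
  is_derive x 1 g l -> (\forall y \near x, 0 <= y -> f y = g y) ->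
  hl_quotient f x --> l.
Proof.
move=> x0 [dg <-] fg.
have gq : (g y - g x) / (y - x) @[y --> x^'] --> 'D_1 g x.
  have := dg; rewrite /derivable.
  move=> /cvg_ex[l' gl'].
  have -> : 'D_1 g x = l' by apply/cvg_lim.
  move=> A /gl' [e /= e0 eP]; exists e => //= y yx ynx.
  have := eP (y - x); rewrite /= sub0r opprB => /(_ yx).
  rewrite subr_eq0 => /(_ ynx).
  by rewrite /= scaler1 subrK [_ *: _]mulrC.
have fx : f x = g x by move: fg => /nbhs_singleton; exact.
rewrite /hl_quotient => A /gq; rewrite /nbhs/= => -[e /= e0 eP].
move: fg => [d /= d0 dP].
exists (Num.min e d); first by rewrite /= lt_min e0.
move=> y /=; rewrite lt_min => /andP[ye yd] yx.
rewrite in_itv/= andbT => y0.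
by rewrite fx dP//; exact: eP.
Qed.

Lemma hl_derive_near (R : realType) (f g : R -> R) (x l : R) : 0 <= x ->
  is_derive x 1 g l -> (\forall y \near x, 0 <= y -> f y = g y) ->
  hl_derivable f x /\ hl_derive f x = l.
Proof.
move=> x0 dg fg; have qc := hl_quotient_cvg x0 dg fg; split.
  by apply/cvg_ex; exists l.
have ? := within_halfline_proper x0.
exact/cvg_lim.
Qed.

(** Iterated one-sided derivatives are meaningful on the half-line only, so near
    each of its points the agreement is required on its side only. *)
Definition locally_smooth (R : realType) (f : R -> R) := forall x : R, 0 <= x ->
  exists2 g : R -> R, smooth g & \forall y \near x, 0 <= y -> f y = g y.

Lemma locally_smooth_derive (R : realType) (f : R -> R) :
  locally_smooth f -> locally_smooth (@hl_derive R f).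
Proof.
move=> fs x x0; have [g gs fg] := fs x x0.
have [g' dg g's] := smooth_ex_deriv gs.
exists g' => //; move/nbhs_interior : fg; apply: filterS => y fgy y0.
by have [_] := hl_derive_near y0 (dg y) fgy.
Qed.

(** [hl_derive f x] depends only on the values of [f] near [x] in the half-line,
    so local smoothness passes from [f] to [hl_derive f]. *)
Lemma hl_smoothP (R : realType) (f : R -> R) :
  locally_smooth f -> hl_smooth f.
Proof.
move=> fs n; have : locally_smooth (iter n (@hl_derive R) f).
  by elim: n => [//|n IH]; rewrite iterS; exact: locally_smooth_derive.
move=> {}fs x x0; have [g gs fg] := fs x x0.
have [g' dg g's] := smooth_ex_deriv gs.
by have [] := hl_derive_near x0 (dg x) fg.
Qed.

(** * A smooth step *)

Lemma is_derive_quad (R : realType) (f : R -> R) (c : R) :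
  (forall x, `|f x| <= c * x ^+ 2) -> is_derive (0 : R) 1 f 0.
Proof.
move=> fc; apply/is_derive1_caratheodory.
have f0 : f 0 = 0 by apply/eqP; rewrite -normr_le0 (le_trans (fc 0))// expr0n mulr0.
exists (fun x => f x / x); split => //.
- move=> x; rewrite f0 !subr0; have [->|x0] := eqVneq x 0; first by rewrite mulr0.
  by rewrite divfK.
- have c0 : 0 <= c by rewrite (le_trans (normr_ge0 _) (le_trans (fc 1) _))// expr1n mulr1.
  rewrite /prop_for /continuous_at f0 mul0r.
  apply/cvgr0Pnorm_le => e e0; exists (e / (c + 1)) => /=.
    by rewrite divr_gt0// ltr_wpDl.
  move=> x /=; rewrite sub0r normrN => xe.
  have [->|x0] := eqVneq x 0; first by rewrite invr0 mulr0 normr0 ltW.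
  rewrite normrM normfV ler_pdivrMr ?normr_gt0//.
  rewrite (le_trans (fc x))// -normr_id -(@real_normK _ x) ?num_real// expr2 normr_id mulrA.
  rewrite ler_pM// ?mulr_ge0//.
  move: xe; rewrite ltr_pdivlMr ?ltr_wpDl// => /ltW; apply: le_trans.
  by rewrite mulrDr mulr1 mulrC lerDl.
- by rewrite f0 mul0r.
Qed.

Lemma is_deriveXf (R : realType) (f : R -> R) n (x a : R) :
  is_derive x 1 f a ->
  is_derive x 1 (fun y => f y ^+ n) (n%:R * f x ^+ n.-1 * a).
Proof.
move=> fa; elim: n => [|n IH]; first by rewrite !mul0r; exact: is_derive_cst.
apply: (@is_derive_ext _ (fun y => f y * f y ^+ n)) => [y|].
  by rewrite exprS.
apply: is_derive_val (is_deriveMf fa IH) _.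
case: n {IH} => [|n] /=; first by rewrite !expr0; ring.
by rewrite !exprS -natr1; ring.
Qed.

(** The functions x^(-n) exp(-1/x), extended by 0, are treated as one family
    because differentiation stays within its linear span. *)
Definition flat (R : realType) (n : nat) (x : R) : R :=
  if 0 < x then x^-1 ^+ n * expR (- x^-1) else 0.

(** From t^(n+2) / (n+2)! <= exp t at t = 1/x. *)
Lemma flat_quad (R : realType) n (x : R) :
  `|flat n x| <= (n.+2)`!%:R * x ^+ 2.
Proof.
rewrite /flat; case: ifPn => x0; last by rewrite normr0 mulr_ge0 ?sqr_ge0.
have xV0 : 0 < x^-1 by rewrite invr_gt0.
rewrite ger0_norm ?mulr_ge0 ?expR_ge0 ?exprn_ge0 ?(ltW xV0)//.
have := expR_ge1Dxn n.+1 (ltW xV0).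
set E := expR _; have E0 : 0 < E by exact: expR_gt0.
rewrite expRN -/E => h.
have {}h : x^-1 ^+ n.+2 <= n.+2`!%:R * E.
  rewrite mulrC -ler_pdivrMr ?ltr0n ?fact_gt0//.
  by apply: le_trans h; rewrite lerDr.
rewrite ler_pdivrMr// mulrAC -ler_pdivrMr ?exprn_gt0//.
by rewrite -exprVn -exprD addn2.
Qed.

Lemma is_derive_flat (R : realType) n (x : R) :
  is_derive x 1 (flat n) (flat n.+2 x + - n%:R * flat n.+1 x).
Proof.
have [x0|x0|->] := ltgtP x 0.
- rewrite {2 3}/flat !ltNge (ltW x0)/= mulr0 addr0.
  apply: (@near_eq_is_derive _ _ _ (fun=> 0) (flat n)).
    near=> y; rewrite /flat ltNge (_ : y <= 0)//.
    by apply/ltW; near: y; exact: lt_nbhsl.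
- rewrite {2 3}/flat x0.
  apply: (@near_eq_is_derive _ _ _ (fun y : R => y^-1 ^+ n * expR (- y^-1)) (flat n)).
  + near=> y; rewrite /flat ifT//.
    by near: y; exact: lt_nbhsr.
  + have dV : is_derive x 1 (fun y : R => y^-1) (- 1 / x ^+ 2).
      by apply: (@is_deriveVf R id) => //; rewrite gt_eqF.
    have dE : is_derive x 1 (fun y : R => expR (- y^-1)) (expR (- x^-1) * - (- 1 / x ^+ 2)).
      by apply: (@is_derive_compf R expR); apply: is_deriveNf.
    have dX : is_derive x 1 (fun y : R => y^-1 ^+ n) ((n%:R * x^-1 ^+ n.-1) * (- 1 / x ^+ 2)).
      exact: is_deriveXf dV.
    apply: is_derive_val (is_deriveMf dX dE) _.
    case: n {dX} => [|n]; rewrite ?mul0r ?expr0/=; first by field; rewrite gt_eqF.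
    have xn0 : x != 0 by rewrite gt_eqF.
    by rewrite !exprVn !exprS; field; rewrite ?expf_neq0 ?xn0.
- rewrite {2 3}/flat ltxx mulr0 addr0.
  exact: is_derive_quad (flat_quad n).
Unshelve. all: end_near.
Qed.

Lemma smooth_flat (R : realType) n : smooth (@flat R n).
Proof.
move=> k; elim: k n => [//|k IH] n.
exists (fun x => flat n.+2 x + - n%:R * flat n.+1 x).
  exact: is_derive_flat.
by apply: Ck_add => //; apply: Ck_mul => //; exact: Ck_cst.
Qed.

(** The step is defined first and the bump as its derivative: the integral of
    the bump over any interval is then explicit. *)
Definition smooth_step (R : realType) (x : R) : R :=
  flat 0 x / (flat 0 x + flat 0 (- 1 * x + 1)).

Lemma flat0_gt0 (R : realType) (x : R) : 0 < x -> 0 < flat 0 x.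
Proof. by move=> x0; rewrite /flat x0 expr0 mul1r expR_gt0. Qed.

Lemma flat0_ge0 (R : realType) (x : R) : 0 <= flat 0 x.
Proof. by rewrite /flat; case: ifP => // _; rewrite expr0 mul1r expR_ge0. Qed.

Lemma flat_le0 (R : realType) n (x : R) : x <= 0 -> flat n x = 0.
Proof. by rewrite /flat ltNge => ->. Qed.

Lemma step_den_gt0 (R : realType) (x : R) : 0 < flat 0 x + flat 0 (- 1 * x + 1).
Proof.
have [x0|x0] := ltP 0 x; first by rewrite ltr_pwDl ?flat0_gt0 ?flat0_ge0.
by rewrite ltr_wpDl ?flat0_ge0// flat0_gt0//; lra.
Qed.

Lemma smooth_smooth_step (R : realType) : smooth (@smooth_step R).
Proof.
move=> n; apply: Ck_mul; first exact: smooth_flat.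
apply: Ck_inv => [x|]; first by rewrite gt_eqF// step_den_gt0.
apply: Ck_add; first exact: smooth_flat.
apply: (@Ck_comp _ _ (flat 0)); first exact: smooth_flat.
exact: Ck_lin.
Qed.

Lemma smooth_step_le0 (R : realType) (x : R) : x <= 0 -> smooth_step x = 0.
Proof. by move=> x0; rewrite /smooth_step flat_le0// mul0r. Qed.

Lemma smooth_step_ge1 (R : realType) (x : R) : 1 <= x -> smooth_step x = 1.
Proof.
move=> x1; rewrite /smooth_step [flat 0 (_ + _)]flat_le0; last by lra.
by rewrite addr0 divff// gt_eqF// flat0_gt0//; lra.
Qed.

Lemma smooth_step_ge0 (R : realType) (x : R) : 0 <= smooth_step x.
Proof. by rewrite divr_ge0 ?flat0_ge0// ltW// step_den_gt0. Qed.

Lemma smooth_bounded (R : realType) (f : R -> R) : smooth f ->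
  (forall x, x <= 0 -> f x = 0) -> (forall x, 1 <= x -> f x = 0) ->
  exists2 c, 0 < c & forall x, `|f x| <= c.
Proof.
move=> /smooth_continuous fc f0 f1.
have cn : {within `[(0:R), 1], continuous (fun x => `|f x|)}.
  apply: continuous_subspaceT => x.
  by apply: cvg_norm; exact: fc.
have [c _ cP] := EVT_max ler01 cn.
exists (`|f c| + 1); first by rewrite ltr_wpDl.
move=> x; have [x0|x0] := leP x 0; first by rewrite f0// normr0 addr_ge0.
have [x1|x1] := leP 1 x; first by rewrite f1// normr0 addr_ge0.
rewrite (@le_trans _ _ `|f c|) ?lerDl//.
by apply: cP; rewrite in_itv/= !ltW.
Qed.

(** At the end point [a] itself this is the continuity of [f']. *)
Lemma derive_cst_le (R : realType) (f f' : R -> R) (a c : R) :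
  continuous f' -> (forall x : R, is_derive x 1 f (f' x)) ->
  (forall x, x <= a -> f x = c) -> forall x, x <= a -> f' x = 0.
Proof.
move=> f'c df fc.
have lt0 x : x < a -> f' x = 0.
  move=> xa; have : is_derive x 1 f 0.
    apply: (@near_eq_is_derive _ _ _ (fun=> c) f).
      near=> y; rewrite fc//.
      by apply/ltW; near: y; exact: lt_nbhsl.
  by move=> /(@derive_val _ _ _ _ _ _ _) <-; rewrite derive_val.
move=> x; rewrite le_eqVlt => /predU1P[->|]; last exact: lt0.
have /cvg_at_left_filter f'l : f' y @[y --> a] --> f' a by exact: f'c.
suff : f' y @[y --> a^'-] --> (0 : R) by move=> /(cvg_unique _ f'l); apply.
apply: cvg_near_cst; near=> y; apply: lt0.
by near: y; exact: nbhs_left_lt.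
Unshelve. all: end_near.
Qed.

Lemma derive_cst_ge (R : realType) (f f' : R -> R) (a c : R) :
  continuous f' -> (forall x : R, is_derive x 1 f (f' x)) ->
  (forall x, a <= x -> f x = c) -> forall x, a <= x -> f' x = 0.
Proof.
move=> f'c df fc x ax.
have := @derive_cst_le R (fun x => f (- 1 * x + 0))
  (fun x => f' (- 1 * x + 0) * - 1) (- a) c.
move=> /(_ _ _ _ (- x)).
rewrite lerN2 addr0 mulN1r opprK mulrN1 => H.
apply/eqP; rewrite -oppr_eq0; apply/eqP; apply: H => //.
- move=> y; apply: cvgM; last exact: cvg_cst.
  apply: (@continuous_comp _ _ _ (fun x : R => -1 * x + 0) f').
    by apply: is_derive_continuous; exact: is_derive_lin.
  exact: f'c.
- by move=> y; apply: is_derive_compf; exact: is_derive_lin.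
- by move=> y ya; apply: fc; lra.
Qed.

(** [B] is a smooth step and its derivative [b] the shape of a pulse: with height
    eps on an interval of length l, a pulse has mass eps * l, since [B 1 = 1]. *)
Lemma pulse_profile (R : realType) : exists B b b' : R -> R, exists c : R,
  [/\ [/\ smooth b, forall x : R, is_derive x 1 B (b x)
      & forall x : R, is_derive x 1 b (b' x)],
     (forall x, x <= 0 -> B x = 0) /\ (forall x, 0 <= B x), B 1 = 1,
     (forall x, x <= 0 -> b x = 0) /\ (forall x, 1 <= x -> b x = 0)
   & [/\ 0 < c, forall x, `|b x| <= c & forall x, `|b' x| <= c]].
Proof.
have [b dB bs] := smooth_ex_deriv (@smooth_smooth_step R).
have [b' db b's] := smooth_ex_deriv bs.
have bl := derive_cst_le (smooth_continuous bs) dB (@smooth_step_le0 R).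
have br := derive_cst_ge (smooth_continuous bs) dB (@smooth_step_ge1 R).
have b'l := derive_cst_le (smooth_continuous b's) db bl.
have b'r := derive_cst_ge (smooth_continuous b's) db br.
have [c c0 bc] := smooth_bounded bs bl br.
have [c' c'0 b'c] := smooth_bounded b's b'l b'r.
exists (@smooth_step R), b, b', (Num.max c c'); split => //.
- by split; [exact: smooth_step_le0|exact: smooth_step_ge0].
- exact: smooth_step_ge1.
- by split=> [|x|x]; rewrite ?lt_max ?c0// le_max ?bc ?b'c ?orbT.
Qed.

(** * Linear differential systems *)

(** The integral starts to the left of [a] because it is meant for functions that
    vanish on the left of [a]: it is then differentiable at [a] too. *)
Definition primitive (R : realType) (a : R) (f : R -> R) (x : R) : R :=
  \int[@lebesgue_measure R]_(t in `[(a - 1)%R, x]) f t.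

Lemma primitive_le (R : realType) (a : R) (f : R -> R) :
  (forall x, x <= a -> f x = 0) -> forall x, x <= a -> primitive a f x = 0.
Proof.
move=> f0 x xa; rewrite /primitive.
under eq_Rintegral.
  move=> t; rewrite inE/= in_itv/= => /andP[_ tx].
  rewrite f0; last exact: le_trans tx xa.
  over.
by rewrite /Rintegral integral0.
Qed.

Lemma is_derive_primitive (R : realType) (a : R) (f : R -> R) :
  continuous f -> (forall x, x <= a -> f x = 0) ->
  forall x : R, is_derive x 1 (primitive a f) (f x).
Proof.
move=> fc f0 x; have [xa|ax] := ltP x a.
  rewrite f0 ?ltW//.
  apply: (@near_eq_is_derive _ _ _ (fun=> 0) (primitive a f)).
  near=> y; rewrite primitive_le//.
  by apply/ltW; near: y; exact: lt_nbhsl.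
have [||||d e] := @continuous_FTC1_closed R f (a - 1) x (x + 1).
- by rewrite ltrDl.
- apply: continuous_compact_integrable; first exact: segment_compact.
  exact: continuous_subspaceT.
- by rewrite (lt_le_trans _ ax)// ltrBlDr ltrDl.
- exact: fc.
by apply: DeriveDef; [exact: d|rewrite -derive1E].
Unshelve. all: end_near.
Qed.

(** The intervals of centre [u n] and radius 2 c / 2^n are nested. *)
Lemma geometric_limit (R : realType) (u : nat -> R) (c : R) :
  (forall n, `|u n.+1 - u n| <= c / 2 ^+ n) ->
  exists l, forall n, `|u n - l| <= 2 * c / 2 ^+ n.
Proof.
move=> uc.
pose lo n := u n - 2 * c / 2 ^+ n; pose up n := u n + 2 * c / 2 ^+ n.
have c2 n : 2 * c / 2 ^+ n = c / 2 ^+ n + 2 * c / 2 ^+ n.+1.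
  by rewrite exprS; field; rewrite expf_neq0// pnatr_eq0.
have c0 n : 0 <= 2 * c / 2 ^+ n.
  have := uc 0%N; rewrite expr0 divr1 => /(le_trans (normr_ge0 _)) c0.
  by rewrite divr_ge0 ?exprn_ge0// mulr_ge0.
have loS n : lo n <= lo n.+1.
  have := uc n; rewrite ler_norml /lo (c2 n).
  by set p := c / _; set q := _ / _ => /andP[? _]; lra.
have upS n : up n.+1 <= up n.
  have := uc n; rewrite ler_norml /up (c2 n).
  by set p := c / _; set q := _ / _ => /andP[_ ?]; lra.
have lo_le m n : (m <= n)%N -> lo m <= lo n.
  move=> /subnK <-; elim: (n - m)%N => [//|k IH]; rewrite addSn.
  exact: le_trans IH (loS _).
have up_le m n : (m <= n)%N -> up n <= up m.
  move=> /subnK <-; elim: (n - m)%N => [//|k IH]; rewrite addSn.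
  exact: le_trans (upS _) IH.
have lo_up m n : lo m <= up n.
  rewrite (le_trans (lo_le _ _ (leq_maxl m n)))//.
  rewrite (le_trans _ (up_le _ _ (leq_maxr m n)))//.
  by rewrite /lo /up lerD2l ge0_cp.
have ub n : ubound (range lo) (up n) by move=> _ [m _ <-]; exact: lo_up.
exists (sup (range lo)) => n.
have h1 : lo n <= sup (range lo).
  by apply: ub_le_sup; [exists (up 0%N)|exists n].
have h2 : sup (range lo) <= up n by apply: ge_sup => //; exists (lo 0%N), 0%N.
rewrite ler_norml; move: h1 h2; rewrite /lo /up; set q := _ / _ => ? ?.
by apply/andP; split; lra.
Qed.

Lemma geometric_eq0 (R : realType) (a c : R) :
  (forall n : nat, `|a| <= c / 2 ^+ n) -> a = 0.
Proof.
move=> ac; apply/eqP; rewrite -normr_le0 leNgt; apply/negP => a0.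
have := ac (Num.truncn (c / `|a|)).+1.
apply/negP; rewrite -ltNge ltr_pdivrMr ?exprn_gt0//.
rewrite mulrC -ltr_pdivrMr//.
apply: lt_trans (truncnS_gt _) _.
by rewrite -natrX ltr_nat ltn_expl.
Qed.

Lemma uniform_approx_continuous (R : realType) (f : R -> R) (x : R) :
  (forall e, 0 < e -> exists2 g : R -> R, {for x, continuous g} &
     \forall y \near x, `|f y - g y| <= e) -> {for x, continuous f}.
Proof.
move=> fg; apply/cvgrPdist_le => /= e e0.
have e3 : 0 < e / 3 by rewrite divr_gt0.
have [g gc fge] := fg _ e3.
have fgx : `|f x - g x| <= e / 3 by exact: nbhs_singleton fge.
move/cvgrPdist_le : gc => /(_ _ e3) gc.
near=> y.
have h1 : `|f y - g y| <= e / 3 by near: y.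
have h2 : `|g x - g y| <= e / 3 by near: y.
move: fgx h1 h2; rewrite !ler_norml => /andP[? ?] /andP[? ?] /andP[? ?].
by apply/andP; split; lra.
Unshelve. all: end_near.
Qed.

Lemma ler_norm_of_derive (R : realType) (f g f' g' : R -> R) (a : R) :
  f a = 0 -> 0 <= g a -> (forall x, a <= x -> is_derive x 1 f (f' x)) ->
  (forall x, a <= x -> is_derive x 1 g (g' x)) ->
  (forall x, a <= x -> `|f' x| <= g' x) -> forall x, a <= x -> `|f x| <= g x.
Proof.
move=> fa ga df dg fg' x ax; rewrite ler_norml lerNl; apply/andP; split.
- apply: (@ler_of_derive _ (fun x => - f x) g (fun x => - f' x) g' a) => //.
  + by rewrite fa oppr0.
  + by move=> y ay _; apply: is_deriveNf; exact: df.
  + by move=> y ay _; exact: dg.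
  + by move=> y ay _; rewrite (le_trans _ (fg' _ ay))// -normrN ler_norm.
- apply: (@ler_of_derive _ f g f' g' a) => //.
  + by rewrite fa.
  + by move=> y ay _; exact: df.
  + by move=> y ay _; exact: dg.
  + by move=> y ay _; rewrite (le_trans _ (fg' _ ay))// ler_norm.
Qed.

Lemma continuous_sum_mul (R : realType) (I : finType) (A y : I -> R -> R) :
  (forall j, continuous (A j)) -> (forall j, continuous (y j)) ->
  continuous (fun x => \sum_j A j x * y j x).
Proof.
move=> Ac yc x.
apply: cvg_big => [|j _]; first exact: add_continuous.
by apply: cvgM; [exact: Ac|exact: yc].
Qed.

(** Picard iteration.  If L bounds the row sums of [A], one step divides by 2 any
    bound of the form c exp(2 L (x - a)) on the distance of two functions that
    agree on the left of [a].  The exponential weight makes the iteration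
    converge on the whole line, however large the mass of [A] is. *)
Lemma linear_ode (R : realType) (I : finType) (A : I -> I -> R -> R)
    (a M : R) (y0 : I -> R) :
  (forall i j, continuous (A i j)) -> (forall i j x, `|A i j x| <= M) ->
  (forall i j x, x <= a -> A i j x = 0) ->
  exists y : I -> R -> R,
    (forall i (x : R), is_derive x 1 (y i) (\sum_j A i j x * y j x)) /\
    (forall i x, x <= a -> y i x = y0 i).
Proof.
move=> Ac AM A0.
pose rhs (y : I -> R -> R) i x := \sum_j A i j x * y j x.
pose T (y : I -> R -> R) i x := y0 i + primitive a (rhs y i) x.
have rhs0 y i x : x <= a -> rhs y i x = 0.
  by move=> xa; rewrite /rhs big1// => j _; rewrite A0// mul0r.
have Ta y i x : x <= a -> T y i x = y0 i.
  by move=> xa; rewrite /T primitive_le ?addr0//; exact: rhs0.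
have dT y i : (forall j, continuous (y j)) ->
    forall x : R, is_derive x 1 (T y i) (rhs y i x).
  move=> yc x; rewrite -[rhs y i x]add0r.
apply: (@is_deriveDf _ (fun=> y0 i) (primitive a (rhs y i))).
  by apply: is_derive_primitive; [exact: continuous_sum_mul|exact: rhs0].
have M0 (i : I) : 0 <= M by rewrite (le_trans (normr_ge0 _) (AM i i 0)).
pose L := #|I|%:R * M; pose w (x : R) := expR (2 * L * (x - a)).
have L0 : I -> 0 <= L by move=> i; rewrite mulr_ge0 ?(M0 i).
have rhsB (y z : I -> R -> R) i (x c : R) : (forall j, `|y j x - z j x| <= c) ->
    `|rhs y i x - rhs z i x| <= L * c.
  move=> yz; rewrite /rhs -sumrB (le_trans (ler_norm_sum _ _ _))//.
  rewrite /L -mulrA -sumr_const big_distrl/=; apply: ler_sum => j _.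
  by rewrite mul1r -mulrBr normrM ler_pM.
have dw (c x : R) : is_derive x 1 (fun y => c * w y) (c * (w x * (2 * L))).
  have dlin : is_derive x 1 (fun x : R => 2 * L * (x - a)) (2 * L).
    apply: (@is_derive_ext _ (fun x => 2 * L * x + (2 * L) * (- a))) => [y|].
      by rewrite -mulrDr.
    exact: is_derive_lin.
  have dexp := is_derive_compf (is_derive_expR _) dlin.
  apply: is_derive_val (is_deriveMf (is_derive_cst c x 1) dexp) _.
  by rewrite mul0r add0r.
have w0 x : 0 < w x by exact: expR_gt0.
have step (y z : I -> R -> R) (c : R) : 0 <= c ->
    (forall j, continuous (y j)) -> (forall j, continuous (z j)) ->
    (forall j x, `|y j x - z j x| <= c * w x) ->
    forall i x, `|T y i x - T z i x| <= c / 2 * w x.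
  move=> c0 yc zc yz i x.
  have [xa|ax] := leP x a.
    by rewrite !Ta// subrr normr0 mulr_ge0 ?divr_ge0// ltW.
  apply: (@ler_norm_of_derive _ (fun x => T y i x - T z i x)
    (fun x => c / 2 * w x) (fun x => rhs y i x - rhs z i x)
    (fun x => c / 2 * (w x * (2 * L))) a) => //.
  - by rewrite !Ta// subrr.
  - by rewrite mulr_ge0 ?divr_ge0// ltW.
  - by move=> t _; apply: is_deriveBf; exact: dT.
  - move=> t _; have -> : c / 2 * (w t * (2 * L)) = L * (c * w t) by field.
    exact: rhsB.
  - exact: ltW.
pose u n := iter n T (fun i _ => y0 i).
have uc n i : continuous (u n i).
  elim: n i => [|n IH] i /=; first by move=> x; exact: cvg_cst.
  by move=> x; apply: is_derive_continuous; exact: dT.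
pose D : R := \sum_i `|y0 i|.
have D0 : 0 <= D by exact: sumr_ge0.
have y0D i : `|y0 i| <= D.
  by rewrite /D (bigD1 i)//= lerDl sumr_ge0.
have uS n i x : `|u n.+1 i x - u n i x| <= D * w x / 2 ^+ n.
  elim: n i x => [|n IH] i x; last first.
    have -> : D * w x / 2 ^+ n.+1 = D / 2 ^+ n / 2 * w x.
      by rewrite exprS; field; rewrite expf_neq0// pnatr_eq0.
    apply: (step (u n.+1) (u n) _ _ (uc n.+1) (uc n)) => [|j t].
      by rewrite divr_ge0// exprn_ge0.
    by rewrite mulrAC; exact: IH.
  rewrite expr0 divr1 /=.
  have [xa|ax] := leP x a.
    by rewrite !Ta// subrr normr0 mulr_ge0// ltW.
  apply: (@ler_norm_of_derive _ (fun x => T (fun i _ => y0 i) i x - y0 i)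
    (fun x => D * w x) (fun x => rhs (fun i _ => y0 i) i x)
    (fun x => D * (w x * (2 * L))) a) => //; last exact: ltW.
  - by rewrite !Ta// subrr.
  - by rewrite mulr_ge0// ltW.
  - move=> t _; rewrite -[rhs _ _ _]subr0.
    apply: (@is_deriveBf _ _ (fun=> y0 i)).
    by apply: dT => j s; exact: cvg_cst.
  - move=> t at'.
    have w1 : 1 <= w t.
      rewrite -expR0 ler_expR mulr_ge0 ?subr_ge0//.
      by rewrite mulr_ge0// (L0 i).
    have := @rhsB (fun i _ => y0 i) (fun _ _ => 0) i t D.
    rewrite /= [rhs (fun _ _ => 0) _ _]big1 => [|j _]; last by rewrite mulr0.
    rewrite subr0 => h; rewrite (le_trans (h _))//.
      by move=> j; rewrite subr0.
    have -> : D * (w t * (2 * L)) = L * D * (2 * w t) by ring.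
    by rewrite ler_peMr//; 
      [rewrite mulr_ge0// (L0 i)|rewrite (le_trans w1)// ler_peMl ?ler1n// ltW].
have /choice[yf yP] : forall p : I * R, exists l, forall n,
    `|u n p.1 p.2 - l| <= 2 * (D * w p.2) / 2 ^+ n.
  by move=> p; apply: geometric_limit => n; exact: uS.
(* The limit y of the iterates solves the integral equation y = T y. *)
pose y i x := yf (i, x).
have uy n i x : `|u n i x - y i x| <= 2 * D / 2 ^+ n * w x.
  have -> : 2 * D / 2 ^+ n * w x = 2 * (D * w x) / 2 ^+ n by ring.
  exact: (yP (i, x) n).
have yc i : continuous (y i).
  move=> x; apply: uniform_approx_continuous => e e0.
  pose c := 2 * (D * w (x + 1)).
  have [n cn] : exists n : nat, c / 2 ^+ n <= e.
    exists (Num.truncn (c / e)).+1; rewrite ler_pdivrMr ?exprn_gt0//.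
    rewrite mulrC -ler_pdivrMr// ltW// (lt_trans (truncnS_gt _))//.
    by rewrite -natrX ltr_nat ltn_expl.
  exists (u n i); first exact: uc.
  near=> t; rewrite distrC (le_trans (uy n i t))// (le_trans _ cn)//.
  have -> : 2 * D / 2 ^+ n * w t = 2 * (D * w t) / 2 ^+ n by ring.
  rewrite ler_pM2r ?invr_gt0 ?exprn_gt0// ler_pM2l// ler_wpM2l//.
  rewrite ler_expR ler_wpM2l ?(mulr_ge0 _ (L0 i))//.
 rewrite lerD2r; apply: ltW; near: t; apply: lt_nbhsl.
  by rewrite ltrDl.
have yT i : y i = T y i.
  apply/funext => x; apply/eqP; rewrite -subr_eq0; apply/eqP.
  apply: (@geometric_eq0 _ _ (2 * D * w x)) => n.
  have h1 := uy n.+1 i x.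
  have h2 : `|u n.+1 i x - T y i x| <= 2 * D / 2 ^+ n / 2 * w x.
    apply: (step (u n) y _ _ (uc n) yc) => [|j t]; last exact: uy.
    by rewrite divr_ge0 ?exprn_ge0 ?mulr_ge0.
  have -> : y i x - T y i x = (u n.+1 i x - T y i x) - (u n.+1 i x - y i x).
    by ring.
  rewrite (le_trans (ler_normB _ _))// (le_trans (lerD h2 h1))//.
  by rewrite exprS le_eqVlt; apply/orP; left; apply/eqP; field; rewrite expf_neq0 ?pnatr_eq0.
exists y; split=> i x; rewrite [y i]yT; last exact: Ta.
exact: dT.
Unshelve. all: end_near.
Qed.

(** * Solutions during a pulse *)

Definition sqmod (R : realType) (F G : R -> R) (x : R) : R :=
  F x ^+ 2 + G x ^+ 2.

(** The equation y' = - (A + i B) conj(y) for y = F + i G. *)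
Definition reflected_ode (R : realType) (A B F G : R -> R) : Prop :=
  forall x : R,
    is_derive x 1 F (- (A x * F x + B x * G x)) /\
    is_derive x 1 G (- (B x * F x - A x * G x)).

Lemma reflected_ode_exists (R : realType) (A B : R -> R) (a M f0 g0 : R) :
  continuous A -> continuous B ->
  (forall x, `|A x| <= M) -> (forall x, `|B x| <= M) ->
  (forall x, x <= a -> A x = 0 /\ B x = 0) ->
  exists F G : R -> R, reflected_ode A B F G /\
    (forall x, x <= a -> F x = f0 /\ G x = g0).
Proof.
move=> Ac Bc AM BM AB0.
pose m (i j : bool) (x : R) : R :=
  if i then (if j then - A x else - B x) else (if j then - B x else A x).
have cN (f : R -> R) : continuous f -> continuous (fun x => - f x).
  by move=> fc x; apply: cvgN; exact: fc.
have [| | |y [dy y0]] := @linear_ode R bool m a M (fun i => if i then f0 else g0).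
- by move=> [] [] //=; exact: cN.
- by move=> [] [] x /=; rewrite ?normrN.
- by move=> [] [] x /AB0[/= Ax Bx]; rewrite /m ?Ax ?Bx ?oppr0.
exists (y true), (y false); split.
- move=> x; split.
  + apply: is_derive_val (dy true x) _.
    by rewrite big_bool /m/=; ring.
  + apply: is_derive_val (dy false x) _.
    by rewrite big_bool /m/=; ring.
- by move=> x xa; rewrite !y0.
Qed.

Lemma reflected_ode_cst (R : realType) (A B F G : R -> R) (a b : R) : a <= b ->
  reflected_ode A B F G ->
  (forall x, a <= x -> x <= b -> A x = 0 /\ B x = 0) ->
  F a = F b /\ G a = G b.
Proof.
move=> ab FG AB0; split; apply: derive0_eq => // x ax xb;
  have [A0 B0] := AB0 x ax xb; have [dF dG] := FG x.
- by apply: is_derive_val dF _; rewrite A0 B0; ring.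
- by apply: is_derive_val dG _; rewrite A0 B0; ring.
Qed.

Lemma is_derive_sqr (R : realType) (f : R -> R) (x a : R) :
  is_derive x 1 f a -> is_derive x 1 (fun y => f y ^+ 2) (2 * f x * a).
Proof.
move=> fa; apply: (@is_derive_ext _ (fun y => f y * f y)) => //.
by apply: is_derive_val (is_deriveMf fa fa) _; ring.
Qed.

Lemma is_derive_sqmod (R : realType) (F G : R -> R) (x f g : R) :
  is_derive x 1 F f -> is_derive x 1 G g ->
  is_derive x 1 (sqmod F G) (2 * (F x * f + G x * g)).
Proof.
move=> dF dG.
apply: is_derive_val (is_deriveDf (is_derive_sqr dF) (is_derive_sqr dG)) _.
ring.
Qed.

(** Averaging.  With y = F + i G and e = cs + i sn, the derivative of |y|^2 is
    - 2 a Re(e conj(y)^2), where e oscillates with frequency 2 mu.  Integrating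
    it by parts leads to the corrected energy
    E = |y|^2 + (a / mu) Im(e conj(y)^2), whose derivative is
    (a' / mu) Im(e conj(y)^2): the terms of order a^2 cancel.  Hence the growth
    of E over the pulse is governed by the variation of [a], and not by its
    integral. *)
Lemma off_resonance_bound (R : realType) (a a' cs sn F G : R -> R)
    (mu X l x : R) :
  0 < l -> 0 < `|mu| -> a X = 0 ->
  (forall x : R, is_derive x 1 a (a' x)) ->
  (forall x, `|a x| <= `|mu| / 8) -> (forall x, `|a' x| <= `|mu| / (8 * l)) ->
  (forall x : R, is_derive x 1 cs (- (2 * mu) * sn x)) ->
  (forall x : R, is_derive x 1 sn (2 * mu * cs x)) ->
  (forall x, cs x ^+ 2 + sn x ^+ 2 = 1) ->
  reflected_ode (fun x => a x * cs x) (fun x => a x * sn x) F G ->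
  X <= x -> x <= X + l -> sqmod F G x <= 2 * sqmod F G X.
Proof.
move=> l0 mu0 aX da aB a'B dcs dsn cssn FG Xx xl.
have mun0 : mu != 0 by rewrite -normr_gt0.
pose N := sqmod F G.
have N0 y : 0 <= N y by rewrite addr_ge0// sqr_ge0.
pose P y := sn y * (F y ^+ 2 - G y ^+ 2) - 2 * (cs y * (F y * G y)).
have PN y : `|P y| <= N y.
  rewrite -(@ler_pXn2r _ 2)// ?nnegrE// -normrX ger0_norm ?sqr_ge0//.
  rewrite -subr_ge0.
  have -> : N y ^+ 2 - P y ^+ 2 =
      (cs y * (F y ^+ 2 - G y ^+ 2) + 2 * (sn y * (F y * G y))) ^+ 2.
    have e : N y ^+ 2 = (cs y ^+ 2 + sn y ^+ 2) * N y ^+ 2 by rewrite cssn mul1r.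
    by rewrite e /N /sqmod /P; ring.
  exact: sqr_ge0.
have dP (y : R) : is_derive y 1 P
    (2 * mu * (cs y * (F y ^+ 2 - G y ^+ 2) + 2 * (sn y * (F y * G y)))).
  have [dF dG] := FG y.
  have d1 := is_deriveBf (is_derive_sqr dF) (is_derive_sqr dG).
  have d2 := is_deriveMf (dsn y) d1.
  have d3 := is_deriveMf (dcs y) (is_deriveMf dF dG).
  have d4 := is_deriveMf (is_derive_cst (2 : R) y 1) d3.
  apply: is_derive_val (is_deriveBf d2 d4) _; rewrite /cst /=; ring.
pose E y := N y + mu^-1 * (a y * P y).
have dE (y : R) : is_derive y 1 E (mu^-1 * (a' y * P y)).
  have [dF dG] := FG y.
  have d1 := is_derive_sqmod dF dG.
  have d2 := is_deriveMf (is_derive_cst (mu^-1 : R) y 1) (is_deriveMf (da y) (dP y)).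
  apply: is_derive_val (is_deriveDf d1 d2) _.
  by rewrite /cst /=; field.
have muM (c d : R) y : `|c| <= `|mu| / d -> 0 < d -> `|mu^-1 * (c * P y)| <= N y / d.
  move=> cd d0; rewrite !normrM normfV mulrA.
  rewrite [N y / d]mulrC ler_pM// ?mulr_ge0 ?invr_ge0//.
  by rewrite mulrC ler_pdivrMr// mulrC.
have EN y : `|E y - N y| <= N y / 8.
  by rewrite /E addrC addKr; apply: muM.
have E'N y : `|mu^-1 * (a' y * P y)| <= N y / (8 * l).
  by apply: muM => //; rewrite mulr_gt0.
(* E is comparable with N: this is where |a| <= |mu| / 8 enters. *)
have E_lo y : 7 / 8 * N y <= E y.
  by have := EN y; rewrite ler_norml => /andP[? _]; lra.
have E0 y : 0 <= E y by rewrite (le_trans _ (E_lo y))// mulr_ge0// divr_ge0.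
pose k := (7 * l)^-1.
have k0 : 0 < k by rewrite invr_gt0 mulr_gt0.
have E'E y : mu^-1 * (a' y * P y) <= k * E y.
  rewrite (le_trans (ler_norm _))// (le_trans (E'N y))//.
  have -> : N y / (8 * l) = k * (7 / 8 * N y).
    by rewrite /k; field; rewrite gt_eqF.
  by rewrite ler_wpM2l// ltW.
have kl : k * l = 1 / 7 by rewrite /k; field; rewrite gt_eqF.
(* A linear weight replaces the exponential in Gronwall's inequality, as the
   exponent k l = 1/7 is small. *)
have H : E x * (- k * x + (1 + k * X)) <= E X.
  pose H y := E y * (- k * y + (1 + k * X)).
  apply: (@ler_of_derive _ H (fun=> E X)
    (fun y => mu^-1 * (a' y * P y) * (- k * y + (1 + k * X)) + E y * - k)
    (fun=> 0) X x) => //.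
  - by rewrite /H le_eqVlt; apply/orP; left; apply/eqP; ring.
  - by move=> y _ _; apply: is_deriveMf => //; exact: is_derive_lin.
  - move=> y Xy yx.
    have s0 : 0 <= y - X by rewrite subr_ge0.
    have sl : k * (y - X) <= 1 / 7.
      rewrite -kl ler_wpM2l ?(ltW k0)// lerBlDl.
      exact: le_trans yx _.
    have -> : - k * y + (1 + k * X) = 1 - k * (y - X) by ring.
    have t0 : 0 <= 1 - k * (y - X) by lra.
    have := ler_wpM2r t0 (E'E y).
    have : 0 <= k * E y * (k * (y - X)) by rewrite !mulr_ge0 ?E0// ltW.
    lra.
have EX : E X = N X by rewrite /E aX mul0r mulr0 addr0.
have fac : 6 / 7 <= - k * x + (1 + k * X).
  have : k * (x - X) <= 1 / 7 by rewrite -kl ler_wpM2l ?(ltW k0)// lerBlDl.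
  lra.
have := ler_wpM2l (E0 x) fac; have := E_lo x; have := N0 X.
rewrite -/(N x) -/(N X); move: H; rewrite EX.
set u := E x * _; set n := N x; set m := N X; set e := E x; lra.
Qed.

(** Real and imaginary parts of W exp(2 i lam x), where W = q + i p. *)
Definition rot_re (R : realType) (p q : R -> R) (lam x : R) : R :=
  q x * cos (2 * lam * x) - p x * sin (2 * lam * x).

Definition rot_im (R : realType) (p q : R -> R) (lam x : R) : R :=
  p x * cos (2 * lam * x) + q x * sin (2 * lam * x).

Definition rot_solution (R : realType) (p q : R -> R) (lam : R) (F G : R -> R) :=
  reflected_ode (rot_re p q lam) (rot_im p q lam) F G.

(** C + i S is the square of the phase of x + i y, so that
    (C + i S) conj(x + i y) = x + i y; any phase does if x = y = 0. *)
Lemma resonant_phase (R : realType) (x y : R) : exists C S : R,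
  [/\ C ^+ 2 + S ^+ 2 = 1, C * x + S * y = x & S * x - C * y = y].
Proof.
pose r := x ^+ 2 + y ^+ 2.
have [r0|r0] := eqVneq r 0.
  have [x0 y0] : x = 0 /\ y = 0.
    move: r0 => /eqP; rewrite paddr_eq0 ?sqr_ge0// !sqrf_eq0.
    by move=> /andP[/eqP -> /eqP ->].
  by exists 1, 0; rewrite x0 y0; split; ring.
exists ((x ^+ 2 - y ^+ 2) / r), (2 * x * y / r).
by split; rewrite /r; field; exact: r0.
Qed.

Lemma Ck_cos_lin (R : realType) n (k : R) : Ck n (fun x => cos (k * x)).
Proof.
have := @Ck_comp _ _ _ (fun x => k * x + 0) (proj2 (Ck_sin_cos R n)) (Ck_lin n k 0).
by under eq_fun do rewrite addr0.
Qed.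

Lemma Ck_sin_lin (R : realType) n (k : R) : Ck n (fun x => sin (k * x)).
Proof.
have := @Ck_comp _ _ _ (fun x => k * x + 0) (proj1 (Ck_sin_cos R n)) (Ck_lin n k 0).
by under eq_fun do rewrite addr0.
Qed.

Lemma is_derive_mull (R : realType) (k x : R) : is_derive x 1 (fun y => k * y) k.
Proof.
apply: (@is_derive_ext _ (fun y => k * y + 0)) => [y|]; first by rewrite addr0.
exact: is_derive_lin.
Qed.

Lemma is_derive_cos_lin (R : realType) (k x : R) :
  is_derive x 1 (fun y => cos (k * y)) (- sin (k * x) * k).
Proof.
by apply: (@is_derive_compf R cos); exact: is_derive_mull.
Qed.

Lemma is_derive_sin_lin (R : realType) (k x : R) :
  is_derive x 1 (fun y => sin (k * y)) (cos (k * x) * k).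
Proof.
by apply: (@is_derive_compf R sin); exact: is_derive_mull.
Qed.

Lemma pulse_rotation (R : realType) (a C S lt lam x : R) :
  let q := a * (C * cos (2 * lt * x) + S * sin (2 * lt * x)) in
  let p := a * (S * cos (2 * lt * x) - C * sin (2 * lt * x)) in
  let k := 2 * (lam - lt) in
  q * cos (2 * lam * x) - p * sin (2 * lam * x) =
    a * (C * cos (k * x) - S * sin (k * x)) /\
  p * cos (2 * lam * x) + q * sin (2 * lam * x) =
    a * (S * cos (k * x) + C * sin (k * x)).
Proof.
move=> q p k.
have -> : k * x = 2 * lam * x - 2 * lt * x by rewrite /k; ring.
by rewrite cosB sinB /q /p; split; ring.
Qed.

(** One pulse tuned to [lam t], of height [eps] on [X, X + l], for solutions that
    start at [X] from the values [s].  The phase of the pulse is taken from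
    [s t]; the solution for [lam t] is then explicit. *)
Lemma pulse_exists (R : realType) (B b b' : R -> R) (c : R)
    (lam : nat -> R) (t : nat) (X l eps : R) (s : nat -> R * R) :
  smooth b -> (forall x : R, is_derive x 1 B (b x)) ->
  (forall x : R, is_derive x 1 b (b' x)) ->
  (forall x, x <= 0 -> B x = 0) -> (forall x, 0 <= B x) -> B 1 = 1 ->
  (forall x, x <= 0 -> b x = 0) -> (forall x, 1 <= x -> b x = 0) ->
  (forall x, `|b x| <= c) -> (forall x, `|b' x| <= c) ->
  0 < l -> 0 <= eps ->
  exists p q : R -> R, exists F G : nat -> R -> R,
  [/\ smooth p /\ smooth q,
      forall x, x <= X \/ X + l <= x -> p x = 0 /\ q x = 0,
      forall x, p x ^+ 2 + q x ^+ 2 <= (eps * c) ^+ 2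
    & forall j, [/\ rot_solution p q (lam j) (F j) (G j),
        forall x, x <= X -> F j x = (s j).1 /\ G j x = (s j).2,
        j = t -> forall x, sqmod (F j) (G j) x <=
          sqmod (F j) (G j) X * expR (- (2 * eps * l * B ((x - X) / l)))
      & 0 < `|lam j - lam t| -> eps * c <= `|lam j - lam t| / 8 ->
        forall x, X <= x -> x <= X + l ->
        sqmod (F j) (G j) x <= 2 * sqmod (F j) (G j) X]].
Proof.
move=> bs dB db B0 Bge0 B1 b0 b1 bc b'c l0 eps0.
have [C [S [CS Cx Sx]]] := resonant_phase (s t).1 (s t).2.
pose r x := l^-1 * x + - (X / l).
have rE x : r x = (x - X) / l by rewrite /r mulrBl mulrC.
have r0 x : x <= X -> r x <= 0.
  by move=> xX; rewrite rE pmulr_lle0 ?invr_gt0// subr_le0.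
have r1 x : X + l <= x -> 1 <= r x.
  by move=> xX; rewrite rE ler_pdivlMr// mul1r lerBrDl.
have dr (x : R) : is_derive x 1 r l^-1 by exact: is_derive_lin.
pose a x := eps * b (r x).
pose a' x := eps * (b' (r x) * l^-1).
have da (x : R) : is_derive x 1 a (a' x).
  have := is_deriveMf (is_derive_cst eps x 1) (is_derive_compf (db (r x)) (dr x)).
  by move/is_derive_val; apply; rewrite /a' /cst/=; ring.
have as_ : smooth a.
  move=> n; apply: Ck_mul; first exact: Ck_cst.
  by apply: (@Ck_comp _ _ b); [exact: bs|exact: Ck_lin].
have a0 x : x <= X \/ X + l <= x -> a x = 0.
  by move=> [/r0/b0|/r1/b1]; rewrite /a => ->; rewrite mulr0.
have aB x : `|a x| <= eps * c.
  by rewrite normrM ger0_norm// ler_wpM2l.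
have a'B x : `|a' x| <= eps * c / l.
  rewrite !normrM ger0_norm// -mulrA ler_wpM2l// normfV (gtr0_norm l0).
  by rewrite ler_wpM2r// invr_ge0 ltW.
pose q x := a x * (C * cos (2 * lam t * x) + S * sin (2 * lam t * x)).
pose p x := a x * (S * cos (2 * lam t * x) - C * sin (2 * lam t * x)).
have pqs : smooth p /\ smooth q.
  split=> n; apply: Ck_mul; [exact: as_| |exact: as_|].
    have -> : (fun x => S * cos (2 * lam t * x) - C * sin (2 * lam t * x)) =
       (fun x => S * cos (2 * lam t * x) + (- C) * sin (2 * lam t * x)).
      by apply/funext => x; rewrite mulNr.
    by apply: Ck_add; apply: Ck_mul; [exact: (Ck_cst n S)|exact: Ck_cos_lin
      |exact: (Ck_cst n (- C))|exact: Ck_sin_lin].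
  by apply: Ck_add; apply: Ck_mul; [exact: (Ck_cst n C)|exact: Ck_cos_lin
    |exact: (Ck_cst n S)|exact: Ck_sin_lin].
have pq0 x : x <= X \/ X + l <= x -> p x = 0 /\ q x = 0.
  by move=> /a0 ax; rewrite /p /q ax !mul0r.
have pqB x : p x ^+ 2 + q x ^+ 2 <= (eps * c) ^+ 2.
  have -> : p x ^+ 2 + q x ^+ 2 = (C ^+ 2 + S ^+ 2) *
     (cos (2 * lam t * x) ^+ 2 + sin (2 * lam t * x) ^+ 2) * a x ^+ 2.
    by rewrite /p /q; ring.
  rewrite CS cos2Dsin2 !mul1r -real_normK ?num_real// lerXn2r ?nnegrE//.
  exact: le_trans (normr_ge0 _) (aB x).
have rot j x : rot_re p q (lam j) x = a x *
      (C * cos (2 * (lam j - lam t) * x) - S * sin (2 * (lam j - lam t) * x)) /\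
    rot_im p q (lam j) x = a x *
      (S * cos (2 * (lam j - lam t) * x) + C * sin (2 * (lam j - lam t) * x)).
  exact: pulse_rotation.
(* The solutions for different j are independent of each other. *)
suff /choice[FG FGP] : forall j, exists FG : (R -> R) * (R -> R),
  [/\ rot_solution p q (lam j) FG.1 FG.2,
      forall x, x <= X -> FG.1 x = (s j).1 /\ FG.2 x = (s j).2,
      j = t -> forall x, sqmod FG.1 FG.2 x <=
          sqmod FG.1 FG.2 X * expR (- (2 * eps * l * B ((x - X) / l)))
    & 0 < `|lam j - lam t| -> eps * c <= `|lam j - lam t| / 8 ->
        forall x, X <= x -> x <= X + l ->
        sqmod FG.1 FG.2 x <= 2 * sqmod FG.1 FG.2 X].
  by exists p, q, (fun j => (FG j).1), (fun j => (FG j).2).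
move=> j; have [->|jt] := eqVneq j t.
  pose e x := expR (- 1 * (eps * l * B (r x))).
  have de (x : R) : is_derive x 1 e (- a x * e x).
    have d1 := is_deriveMf (is_derive_cst (eps * l) x 1)
       (is_derive_compf (dB (r x)) (dr x)).
    have d2 := is_deriveMf (is_derive_cst (- 1 : R) x 1) d1.
    apply: is_derive_val (is_derive_compf (is_derive_expR _) d2) _.
    by rewrite /cst/= /a -/(e x); field; rewrite gt_eqF.
  exists ((fun x => (s t).1 * e x), (fun x => (s t).2 * e x)) => /=; split.
  - move=> x; have [-> ->] := rot t x.
    rewrite subrr mulr0 mul0r cos0 sin0 !mulr0 !mulr1 subr0 addr0.
    have d1 := is_deriveMf (is_derive_cst (s t).1 x 1) (de x).
    have d2 := is_deriveMf (is_derive_cst (s t).2 x 1) (de x).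
    split.
      apply: is_derive_val d1 _; rewrite /cst/=.
      have -> : a x * C * ((s t).1 * e x) + a x * S * ((s t).2 * e x) =
        a x * e x * (C * (s t).1 + S * (s t).2) by ring.
      by rewrite Cx; ring.
    apply: is_derive_val d2 _; rewrite /cst/=.
    have -> : a x * S * ((s t).1 * e x) - a x * C * ((s t).2 * e x) =
      a x * e x * (S * (s t).1 - C * (s t).2) by ring.
    by rewrite Sx; ring.
  - by move=> x xX; rewrite /e B0 ?r0// !mulr0 expR0 !mulr1.
  - move=> _ x; rewrite /sqmod /e (B0 _ (r0 _ (lexx X))) !mulr0 expR0 !mulr1 -rE.
    have -> : - (2 * eps * l * B (r x)) =
        - 1 * (eps * l * B (r x)) + - 1 * (eps * l * B (r x)) by ring.
    by rewrite expRD le_eqVlt; apply/orP; left; apply/eqP; ring.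
  - by rewrite subrr normr0 ltxx.
have [ps qs] := pqs.
have rc k : continuous (rot_re p q k) /\ continuous (rot_im p q k).
  have cc x : {for x, continuous (fun x => cos (2 * k * x))}.
    exact: is_derive_continuous (is_derive_cos_lin (2 * k) x).
  have sc x : {for x, continuous (fun x => sin (2 * k * x))}.
    exact: is_derive_continuous (is_derive_sin_lin (2 * k) x).
  have pc := smooth_continuous ps; have qc := smooth_continuous qs.
  split=> x; [apply: cvgB|apply: cvgD]; apply: cvgM;
    by [exact: pc|exact: qc|exact: cc|exact: sc].
have rB (f g : R -> R) x k : `|f x| <= eps * c -> `|g x| <= eps * c ->
    `|f x * cos k| <= eps * c /\ `|g x * sin k| <= eps * c.
  move=> fx gx; rewrite !normrM; split.
    by rewrite (le_trans _ fx)// ler_piMr// ler_norml cos_geN1 cos_le1.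
  by rewrite (le_trans _ gx)// ler_piMr// ler_norml sin_geN1 sin_le1.
have ec0 : 0 <= eps * c by exact: le_trans (normr_ge0 _) (aB X).
have e2 : 2 * (eps * c) = eps * c + eps * c by ring.
have pB x : `|p x| <= eps * c.
  rewrite -(@ler_pXn2r _ 2)// ?nnegrE// real_normK ?num_real//.
  by rewrite (le_trans _ (pqB x))// lerDl sqr_ge0.
have qB x : `|q x| <= eps * c.
  rewrite -(@ler_pXn2r _ 2)// ?nnegrE// real_normK ?num_real//.
  by rewrite (le_trans _ (pqB x))// lerDr sqr_ge0.
have [|||||F [G [FG FG0]]] := @reflected_ode_exists R (rot_re p q (lam j))
  (rot_im p q (lam j)) X (2 * (eps * c)) (s j).1 (s j).2.
- exact: (rc (lam j)).1.
- exact: (rc (lam j)).2.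
- move=> x; rewrite /rot_re (le_trans (ler_normB _ _))// e2.
  by have [h1 h2] := rB _ _ _ (2 * lam j * x) (qB x) (pB x); exact: lerD.
- move=> x; rewrite /rot_im (le_trans (ler_normD _ _))// e2.
  by have [h1 h2] := rB _ _ _ (2 * lam j * x) (pB x) (qB x); exact: lerD.
- by move=> x xX; rewrite /rot_re /rot_im; have [-> ->] := pq0 x (or_introl xX);
    rewrite !mul0r subr0 addr0.
exists (F, G); split => //=; first by move=> /eqP; rewrite (negPf jt).
move=> mu0 ec x Xx xl.
apply: (@off_resonance_bound R a a'
   (fun x => C * cos (2 * (lam j - lam t) * x) - S * sin (2 * (lam j - lam t) * x))
   (fun x => S * cos (2 * (lam j - lam t) * x) + C * sin (2 * (lam j - lam t) * x))
   F G (lam j - lam t) X l x) => //.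
- by apply: a0; left.
- by move=> y; exact: le_trans (aB y) ec.
- move=> y; rewrite (le_trans (a'B y))// invfM mulrA ler_wpM2r ?invr_ge0 ?(ltW l0)//.
- move=> y.
  have d1 := is_deriveMf (is_derive_cst C y 1) (is_derive_cos_lin (2 * (lam j - lam t)) y).
  have d2 := is_deriveMf (is_derive_cst S y 1) (is_derive_sin_lin (2 * (lam j - lam t)) y).
  by apply: is_derive_val (is_deriveBf d1 d2) _; rewrite /cst/=; ring.
- move=> y.
  have d1 := is_deriveMf (is_derive_cst S y 1) (is_derive_cos_lin (2 * (lam j - lam t)) y).
  have d2 := is_deriveMf (is_derive_cst C y 1) (is_derive_sin_lin (2 * (lam j - lam t)) y).
  by apply: is_derive_val (is_deriveDf d1 d2) _; rewrite /cst/=; ring.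
- move=> y; set w := 2 * _ * y.
  have -> : (C * cos w - S * sin w) ^+ 2 + (S * cos w + C * sin w) ^+ 2 =
    (C ^+ 2 + S ^+ 2) * (cos w ^+ 2 + sin w ^+ 2) by ring.
  by rewrite CS cos2Dsin2 mulr1.
- move: FG; rewrite /rot_solution /reflected_ode => FG y.
  by have [<- <-] := rot j y; exact: FG.
Qed.

(** * Concatenation of pulses over the dyadic blocks *)

Lemma dyadic_bound (R : realType) (x : R) : exists n : nat, x < 2 ^+ n.
Proof.
exists (Num.truncn x).+1; rewrite (lt_trans (truncnS_gt _))//.
by rewrite -natrX ltr_nat ltn_expl.
Qed.

Lemma dyadic_block (R : realType) (x : R) : 1 <= x ->
  exists k : nat, 2 ^+ k <= x /\ x < 2 ^+ k.+1.
Proof.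
move=> x1; have [n] := dyadic_bound x.
elim: n => [|n IH] xn; first by move: xn; rewrite expr0 ltNge x1.
have [nx|] := leP (2 ^+ n) x; [by exists n|exact: IH].
Qed.

(** The sum of all [f k x] when each [f k] vanishes on the left of 2^k; any [n]
    with x < 2^n gives the same value then. *)
Definition dyadic_sum (R : realType) (f : nat -> R -> R) (x : R) : R :=
  \sum_(k < xget 0%N [set n : nat | x < 2 ^+ n]) f k x.

Lemma dyadic_sumE (R : realType) (f : nat -> R -> R) (x : R) (n : nat) :
  (forall k, x <= 2 ^+ k -> f k x = 0) -> x <= 2 ^+ n ->
  dyadic_sum f x = \sum_(k < n) f k x.
Proof.
move=> f0.
have le m n' : (m <= n')%N -> x <= 2 ^+ m ->
    \sum_(k < n') f k x = \sum_(k < m) f k x.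
  move=> /subnKC <- xm; rewrite big_split_ord/= [X in _ + X]big1 ?addr0// => i _.
  by apply: f0; rewrite (le_trans xm)// ler_weXn2l ?ler1n// leq_addr.
move=> xn; rewrite /dyadic_sum.
set m := xget _ _.
have xm : x <= 2 ^+ m.
  apply: ltW; rewrite /m; case: xgetP => [? -> //|/(_ _)].
  by have [k xk] := dyadic_bound x => /(_ k).
have [mn|/ltnW nm] := leqP m n; first by rewrite (le _ _ mn).
by rewrite (le _ _ nm).
Qed.

Lemma dyadic_sum_block (R : realType) (f : nat -> R -> R) (x : R) (n : nat) :
  (forall k, x <= 2 ^+ k \/ 2 ^+ k.+1 <= x -> f k x = 0) ->
  2 ^+ n <= x -> x <= 2 ^+ n.+1 -> dyadic_sum f x = f n x.
Proof.
move=> f0 nx xn; rewrite (@dyadic_sumE _ f x n.+1)//; last by move=> k ?; apply: f0; left.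
rewrite big_ord_recr/= big1 ?add0r// => i _; apply: f0; right.
by rewrite (le_trans _ nx)// ler_weXn2l ?ler1n//.
Qed.

Lemma is_derive_sumf (R : realType) (f : nat -> R -> R) (f' : nat -> R) (x : R) n :
  (forall k, is_derive x 1 (f k) (f' k)) ->
  is_derive x 1 (fun y => \sum_(k < n) f k y) (\sum_(k < n) f' k).
Proof.
move=> df; elim: n => [|n IH].
  rewrite big_ord0; apply: (@is_derive_ext _ (fun=> 0)).
  by move=> y; rewrite big_ord0.
rewrite big_ord_recr; apply: (@is_derive_ext _ (fun y => \sum_(k < n) f k y + f n y)).
  by move=> y; rewrite big_ord_recr.
Qed.

Lemma near_dyadic (R : realType) (f g : R -> R) (x : R) n : x < 2 ^+ n ->
  (forall y, y <= 2 ^+ n -> f y = g y) -> \forall y \near x, f y = g y.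
Proof.
move=> xn fg; near=> y; apply: fg; apply: ltW; near: y; exact: lt_nbhsl.
Unshelve. all: end_near.
Qed.

Lemma locally_smooth_dyadic_sum (R : realType) (f : nat -> R -> R) :
  (forall k, smooth (f k)) -> (forall k x, x <= 2 ^+ k -> f k x = 0) ->
  locally_smooth (dyadic_sum f).
Proof.
move=> fs f0 x _; have [n xn] := dyadic_bound x.
exists (fun x => \sum_(k < n) f k x); first exact: smooth_sum.
have := @near_dyadic _ (dyadic_sum f) (fun x => \sum_(k < n) f k x) x n xn.
move=> /(_ _)/filterS; apply => // y yn.
by apply: dyadic_sumE => // k; exact: f0.
Qed.

(** The values of all solutions at 2^k are the state from which the next pulse is
    chosen.  The state carries every index [j], since any of them may be the
    target of a later pulse. *)
Lemma pulse_sequence (R : realType) : exists2 c : R, 0 < c &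
  forall (lam : nat -> R) (t : nat -> nat) (eps : nat -> R)
    (s0 : nat -> R * R), (forall k, 0 <= eps k) ->
  exists (p q : nat -> R -> R) (F G : nat -> nat -> R -> R),
  [/\ forall k, smooth (p k) /\ smooth (q k),
      forall k x, x <= 2 ^+ k \/ 2 ^+ k.+1 <= x -> p k x = 0 /\ q k x = 0,
      forall k x, p k x ^+ 2 + q k x ^+ 2 <= (eps k * c) ^+ 2,
      forall j x, x <= 1 -> F 0%N j x = (s0 j).1 /\ G 0%N j x = (s0 j).2
    & forall k j, [/\ rot_solution (p k) (q k) (lam j) (F k j) (G k j),
        forall x, x <= 2 ^+ k.+1 ->
           F k.+1 j x = F k j (2 ^+ k.+1) /\ G k.+1 j x = G k j (2 ^+ k.+1),
        j = t k -> (forall x, sqmod (F k j) (G k j) x <= sqmod (F k j) (G k j) (2 ^+ k)) /\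
          sqmod (F k j) (G k j) (2 ^+ k.+1) <=
          sqmod (F k j) (G k j) (2 ^+ k) * expR (- (2 * eps k * 2 ^+ k))
      & 0 < `|lam j - lam (t k)| -> eps k * c <= `|lam j - lam (t k)| / 8 ->
        forall x, 2 ^+ k <= x -> x <= 2 ^+ k.+1 ->
        sqmod (F k j) (G k j) x <= 2 * sqmod (F k j) (G k j) (2 ^+ k)]].
Proof.
have [B [b [b' [c [[bs dB db] [B0 Bge0] B1 [b0 b1] [c0 bc b'c]]]]]] := pulse_profile R.
exists c => // lam t eps s0 eps0.
have l0 k : 0 < 2 ^+ k :> R by rewrite exprn_gt0.
have step (ks : nat * (nat -> R * R)) := @pulse_exists R B b b' c lam (t ks.1) (2 ^+ ks.1)
  (2 ^+ ks.1) (eps ks.1) ks.2 bs dB db B0 Bge0 B1 b0 b1 bc b'c (l0 ks.1) (eps0 ks.1).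
move/choice : step => [P] /choice[Q] /choice[F] /choice[G] PQFG.
pose s := fix s k := if k is m.+1
  then (fun j => (F (m, s m) j (2 ^+ k), G (m, s m) j (2 ^+ k))) else s0.
have e2 k : 2 ^+ k + 2 ^+ k = 2 ^+ k.+1 :> R by rewrite exprS; ring.
exists (fun k => P (k, s k)), (fun k => Q (k, s k)).
exists (fun k => F (k, s k)), (fun k => G (k, s k)); split.
- by move=> k; have [] := PQFG (k, s k).
- by move=> k x; have [_ + _ _] := PQFG (k, s k); rewrite /= e2; exact.
- by move=> k; have [] := PQFG (k, s k).
- move=> j x x1; have [_ _ _ /(_ j) [_ + _ _]] := PQFG (0%N, s 0%N).
  by apply; rewrite /= expr0.
- move=> k j; have [_ _ _ /(_ j)/= [Fsol Fs Ft Fo]] := PQFG (k, s k); split => //.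
  + move=> x xk; have [_ _ _ /(_ j)/= [_ Fs' _ _]] := PQFG (k.+1, s k.+1).
    by have [-> ->] := Fs' x xk.
  + move=> jt; have {}Ft := Ft jt; split.
      move=> x; rewrite (le_trans (Ft x))// ler_piMr ?addr_ge0 ?sqr_ge0//.
      by rewrite expR_le1 oppr_le0 !mulr_ge0// ltW.
    rewrite (le_trans (Ft _))//.
    by rewrite -e2 addrK divff ?gt_eqF// B1 mulr1.
  + by rewrite -e2.
Qed.

Lemma rot_pulse0 (R : realType) (p q : R -> R) (lam x : R) :
  p x = 0 /\ q x = 0 -> rot_re p q lam x = 0 /\ rot_im p q lam x = 0.
Proof.
by rewrite /rot_re /rot_im => -[-> ->]; rewrite !mul0r subr0 addr0.
Qed.

(** Both the potentials and the increments of the solutions vanish on the left of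
    their blocks, so they are glued by [dyadic_sum].  The equation is linear in
    the potential, and the term of block k only sees the solution inside block k,
    where the telescoping sum of increments is the k-th solution. *)
Lemma pulse_train (R : realType) : exists2 c : R, 0 < c &
  forall (lam : nat -> R) (t : nat -> nat) (eps : nat -> R)
    (s0 : nat -> R * R), (forall k, 0 <= eps k) ->
  exists (p q : R -> R) (U V : nat -> R -> R),
  [/\ locally_smooth p /\ locally_smooth q,
      forall x, x <= 1 -> p x = 0 /\ q x = 0,
      forall k x, 2 ^+ k <= x -> x <= 2 ^+ k.+1 ->
        p x ^+ 2 + q x ^+ 2 <= (eps k * c) ^+ 2,
      forall j, rot_solution p q (lam j) (U j) (V j) /\
        forall x, x <= 1 -> U j x = (s0 j).1 /\ V j x = (s0 j).2
    & forall k j, (j = t k ->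
        (forall x, 2 ^+ k <= x -> x <= 2 ^+ k.+1 ->
          sqmod (U j) (V j) x <= sqmod (U j) (V j) (2 ^+ k)) /\
        sqmod (U j) (V j) (2 ^+ k.+1) <=
          sqmod (U j) (V j) (2 ^+ k) * expR (- (2 * eps k * 2 ^+ k))) /\
      (0 < `|lam j - lam (t k)| -> eps k * c <= `|lam j - lam (t k)| / 8 ->
        forall x, 2 ^+ k <= x -> x <= 2 ^+ k.+1 ->
        sqmod (U j) (V j) x <= 2 * sqmod (U j) (V j) (2 ^+ k))].
Proof.
have [c c0 H] := pulse_sequence R; exists c => // lam t eps s0 eps0.
have [p [q [F [G [pqs pq0 pqB FG0 FGP]]]]] := H lam t eps s0 eps0.
have pow_lt k : (2 ^+ k <= 2 ^+ k.+1 :> R) by rewrite ler_weXn2l ?ler1n.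
pose P := dyadic_sum p; pose Q := dyadic_sum q.
have p0 k x : x <= 2 ^+ k \/ 2 ^+ k.+1 <= x -> p k x = 0 by move=> /pq0[].
have q0 k x : x <= 2 ^+ k \/ 2 ^+ k.+1 <= x -> q k x = 0 by move=> /pq0[].
have sol k j : rot_solution (p k) (q k) (lam j) (F k j) (G k j) by have [] := FGP k j.
have FGl k j x : x <= 2 ^+ k -> F k j x = F k j (2 ^+ k) /\ G k j x = G k j (2 ^+ k).
  move=> xk; apply: (reflected_ode_cst xk (sol k j)) => y _ yk.
  by apply: rot_pulse0; apply: pq0; left.
have FGr k j x : 2 ^+ k.+1 <= x ->
    F k j x = F k j (2 ^+ k.+1) /\ G k j x = G k j (2 ^+ k.+1).
  move=> xk; have [-> ->] : F k j (2 ^+ k.+1) = F k j x /\ G k j (2 ^+ k.+1) = G k j x.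
    apply: (reflected_ode_cst xk (sol k j)) => y ky _.
    by apply: rot_pulse0; apply: pq0; right.
  by [].
pose dF j k x := F k j x - F k j (2 ^+ k).
pose dG j k x := G k j x - G k j (2 ^+ k).
have dF0 j k x : x <= 2 ^+ k -> dF j k x = 0.
  by move=> /(FGl k j)[+ _]; rewrite /dF => ->; rewrite subrr.
have dG0 j k x : x <= 2 ^+ k -> dG j k x = 0.
  by move=> /(FGl k j)[_ +]; rewrite /dG => ->; rewrite subrr.
pose U j x := (s0 j).1 + dyadic_sum (dF j) x.
pose V j x := (s0 j).2 + dyadic_sum (dG j) x.
have UVblock k j x : 2 ^+ k <= x -> x <= 2 ^+ k.+1 ->
    U j x = F k j x /\ V j x = G k j x.
  move=> kx xk; rewrite /U /V (dyadic_sumE _ xk)//; last by move=> *; exact: dF0.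
  rewrite (dyadic_sumE _ xk)//; last by move=> *; exact: dG0.
  have [F00 G00] := FG0 j 1 (lexx _).
  rewrite -F00 -G00 !big_ord_recr/=.
  have -> : \sum_(i < k) dF j i x =
      \sum_(0 <= i < k) (F i.+1 j (2 ^+ i.+1) - F i j (2 ^+ i)).
    rewrite big_mkord; apply: eq_bigr => i _; rewrite /dF.
    have [_ /(_ (2 ^+ i.+1) (lexx _))[-> _] _ _] := FGP i j.
    by have [|-> _] := FGr i j x; rewrite // (le_trans _ kx)// ler_weXn2l ?ler1n.
  have -> : \sum_(i < k) dG j i x =
      \sum_(0 <= i < k) (G i.+1 j (2 ^+ i.+1) - G i j (2 ^+ i)).
    rewrite big_mkord; apply: eq_bigr => i _; rewrite /dG.
    have [_ /(_ (2 ^+ i.+1) (lexx _))[_ ->] _ _] := FGP i j.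
    by have [|_ ->] := FGr i j x; rewrite // (le_trans _ kx)// ler_weXn2l ?ler1n.
  by rewrite !telescope_sumr// !expr0 /dF /dG; split; ring.
exists P, Q, U, V; split.
- by split; apply: locally_smooth_dyadic_sum => k;
    [have [] := pqs k|move=> x xk; apply: p0; left|have [] := pqs k|move=> x xk; apply: q0; left].
- move=> x x1.
  rewrite /P /Q !(@dyadic_sumE _ _ x 0%N) ?expr0 ?big_ord0// => k xk;
    by [apply: q0; left|apply: p0; left].
- move=> k x kx xk; rewrite /P (dyadic_sum_block (fun i => p0 i x) kx xk).
  by rewrite /Q (dyadic_sum_block (fun i => q0 i x) kx xk).
- move=> j; split; last first.
    move=> x x1; rewrite /U /V !(@dyadic_sumE _ _ x 0%N) ?expr0 ?big_ord0 ?addr0// => k xk;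
    [exact: dG0|exact: dF0].
  move=> x; have [n xn] := dyadic_bound x.
  have PE : P x = \sum_(k < n) p k x.
    by apply: dyadic_sumE; [move=> k xk; apply: p0; left|exact: ltW].
  have QE : Q x = \sum_(k < n) q k x.
    by apply: dyadic_sumE; [move=> k xk; apply: q0; left|exact: ltW].
  have reE : rot_re P Q (lam j) x = \sum_(k < n) rot_re (p k) (q k) (lam j) x.
    by rewrite /rot_re PE QE !mulr_suml -sumrB.
  have imE : rot_im P Q (lam j) x = \sum_(k < n) rot_im (p k) (q k) (lam j) x.
    by rewrite /rot_im PE QE !mulr_suml -big_split.
  have act k : [/\ rot_re (p k) (q k) (lam j) x * F k j x = rot_re (p k) (q k) (lam j) x * U j x,
    rot_re (p k) (q k) (lam j) x * G k j x = rot_re (p k) (q k) (lam j) x * V j x,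
    rot_im (p k) (q k) (lam j) x * F k j x = rot_im (p k) (q k) (lam j) x * U j x &
    rot_im (p k) (q k) (lam j) x * G k j x = rot_im (p k) (q k) (lam j) x * V j x].
    have [xk|kx] := leP x (2 ^+ k).
      by have [-> ->] := rot_pulse0 (lam j) (pq0 k x (or_introl xk)); rewrite !mul0r.
    have [xk|kx'] := leP (2 ^+ k.+1) x.
      by have [-> ->] := rot_pulse0 (lam j) (pq0 k x (or_intror xk)); rewrite !mul0r.
    by have [-> ->] := UVblock k j x (ltW kx) (ltW kx').
  split.
  + apply: (@near_eq_is_derive _ _ _
      (fun y => (s0 j).1 + \sum_(k < n) (F k j y - F k j (2 ^+ k))) (U j)).
      apply: (near_dyadic xn) => y yn; rewrite /U (dyadic_sumE _ yn)// => k; exact: dF0.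
    have d k := is_deriveBf (proj1 (sol k j x)) (is_derive_cst (F k j (2 ^+ k)) x 1).
    apply: is_derive_val (is_deriveDf (is_derive_cst (s0 j).1 x 1) (is_derive_sumf n d)) _.
    rewrite add0r reE imE !mulr_suml -big_split/= -sumrN; apply: eq_bigr => k _.
    by have [-> _ _ ->] := act k; rewrite subr0.
  + apply: (@near_eq_is_derive _ _ _
      (fun y => (s0 j).2 + \sum_(k < n) (G k j y - G k j (2 ^+ k))) (V j)).
      apply: (near_dyadic xn) => y yn; rewrite /V (dyadic_sumE _ yn)// => k; exact: dG0.
    have d k := is_deriveBf (proj2 (sol k j x)) (is_derive_cst (G k j (2 ^+ k)) x 1).
    apply: is_derive_val (is_deriveDf (is_derive_cst (s0 j).2 x 1) (is_derive_sumf n d)) _.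
    rewrite add0r reE imE !mulr_suml -sumrB/= -sumrN; apply: eq_bigr => k _.
    by have [_ -> -> _] := act k; rewrite subr0.
- move=> k j.
  have sqE x : 2 ^+ k <= x -> x <= 2 ^+ k.+1 ->
      sqmod (U j) (V j) x = sqmod (F k j) (G k j) x.
    by move=> kx xk; rewrite /sqmod; have [-> ->] := UVblock k j x kx xk.
  rewrite !sqE//; have [_ _ on off] := FGP k j; split.
    by move=> /on[on1 on2]; split => // x kx xk; rewrite sqE.
  by move=> mu0 /(off mu0) {}off x kx xk; rewrite sqE//; exact: off.
Qed.

(** * Square integrability *)

(** (1 + x)^(-3/2): integrable, yet larger than M(x)^2 / (1 + x)^2 for a factor M
    that tends slowly to infinity. *)
Definition decay (R : realType) (x : R) : R := ((1 + x) * Num.sqrt (1 + x))^-1.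

Lemma decay_gt0 (R : realType) (x : R) : 0 <= x -> 0 < decay x.
Proof. by move=> x0; rewrite invr_gt0 mulr_gt0 ?sqrtr_gt0 ?ltr_wpDr. Qed.

Lemma is_derive_primitive_decay (R : realType) (x : R) : 0 <= x ->
  is_derive x 1 (fun y : R => - 2 * (Num.sqrt (1 + y))^-1) (decay x).
Proof.
move=> x0; have x1 : 0 < 1 + x by rewrite ltr_wpDr.
have s0 : 0 < Num.sqrt (1 + x) by rewrite sqrtr_gt0.
have dx : is_derive x 1 (fun y : R => 1 + y) 1.
  have d1 := is_deriveDf (is_derive_cst (1 : R) x 1) (is_derive_id x 1).
  by apply: is_derive_val d1 _; rewrite add0r.
have ds := is_derive_compf (is_derive1_sqrt x1) dx.
have dv := @is_deriveVf R (fun y => Num.sqrt (1 + y)) x _ (lt0r_neq0 s0) ds.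
apply: is_derive_val (is_deriveMf (is_derive_cst (- 2 : R) x 1) dv) _.
rewrite mul0r add0r /decay sqr_sqrtr ?ltW// /cst/=; field.
by rewrite !gt_eqF.
Qed.

Lemma decay_continuous (R : realType) (x : R) : 0 <= x -> {for x, continuous (@decay R)}.
Proof.
move=> x0; have x1 : 0 < 1 + x by rewrite ltr_wpDr.
have s0 : 0 < Num.sqrt (1 + x) by rewrite sqrtr_gt0.
apply: cvgV; first by rewrite mulf_neq0// gt_eqF.
have cx : 1 + y @[y --> x] --> 1 + x by apply: cvgD; [exact: cvg_cst|exact: cvg_id].
apply: cvgM => //.
by apply: (cvg_comp _ _ cx); exact: sqrt_continuous.
Qed.

Lemma integral_decay (R : realType) :
  (\int[@lebesgue_measure R]_(x in `[0%R, +oo[) (decay x)%:E = 2%:E)%E.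
Proof.
rewrite (@ge0_continuous_FTC2y R (@decay R) (fun y => - 2 * (Num.sqrt (1 + y))^-1) 0 0).
- rewrite addr0 sqrtr1 invr1 mulr1; congr EFin; ring.
- by move=> x x0; rewrite ltW// decay_gt0.
- apply: continuous_in_subspaceT => x; rewrite inE/= in_itv/= andbT => x0.
  exact: decay_continuous.
- rewrite -[X in _ --> X](mulr0 (- 2)); apply: cvgM; first exact: cvg_cst.
  apply/gtr0_cvgV0.
    near=> x; rewrite sqrtr_gt0 ltr_wpDr//; near: x;
      by apply: nbhs_pinfty_ge; rewrite num_real.
  apply/cvgryPge => A; near=> x.
  have x0 : 0 <= x by near: x; by apply: nbhs_pinfty_ge; rewrite num_real.
  have [A0|A0] := leP A 0; first by rewrite (le_trans A0)// sqrtr_ge0.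
  rewrite -(ger0_norm (ltW A0)) -sqrtr_sqr ler_wsqrtr//.
  rewrite -lerBlDl; near: x; by apply: nbhs_pinfty_ge; rewrite num_real.
- move=> x x0; apply: ex_derive; apply: is_derive_primitive_decay; exact: ltW.
- apply: cvg_at_right_filter.
  exact: (is_derive_continuous (is_derive_primitive_decay (lexx (0 : R)))).
- move=> x; rewrite in_itv/= andbT => x0; rewrite derive1E.
  by have [_ ->] := is_derive_primitive_decay (ltW x0).
Unshelve. all: end_near.
Qed.

Lemma hl_L2_decay (R : realType) (f : R -> R) (c : R) :
  {within `[0, +oo[, continuous f} ->
  (forall x, 0 <= x -> f x ^+ 2 <= c * decay x) -> hl_L2 f.
Proof.
move=> fc fB.
have c0 : 0 <= c.
  have := fB 0 (lexx _); move/(le_trans (sqr_ge0 _)).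
  by rewrite pmulr_lge0// decay_gt0.
have mA : measurable (`[0%R, +oo[ : set R) by exact: measurable_itv.
have mf : measurable_fun setT (f \_ `[0, +oo[).
  apply/(measurable_restrictT f mA).
  exact: subspace_continuous_measurable_fun.
have mw : measurable_fun (`[0%R, +oo[ : set R) (@decay R).
  apply: subspace_continuous_measurable_fun => //.
  apply: continuous_in_subspaceT => x; rewrite inE/= in_itv/= andbT => x0.
  exact: decay_continuous.
rewrite /hl_L2 inE; apply/andP; split; rewrite inE//=.
rewrite /finite_norm unlock /=.
apply: poweR_lty.
under eq_integral => x _ do rewrite powR_mulrn// real_normK ?num_real//.
apply: (@le_lt_trans _ _ (\int[@lebesgue_measure R]_(x in `[0%R, +oo[) (c * decay x)%:E)%E).
  rewrite [leRHS]integral_mkcond.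
  apply: ge0_le_integral => //.
  - by move=> x _; rewrite lee_fin sqr_ge0.
  - by apply/measurable_EFinP; exact: measurable_funX.
  - apply/(measurable_restrictT _ mA); apply/measurable_EFinP.
    by apply: measurable_funM.
  - move=> x _; rewrite !patchE; case: ifPn; last by rewrite expr0n.
    by rewrite inE/= in_itv/= andbT => x0; rewrite lee_fin; exact: fB.
under eq_integral do rewrite EFinM.
rewrite ge0_integralZl//.
- by rewrite integral_decay -EFinM ltry.
- exact/measurable_EFinP.
- by move=> x /=; rewrite in_itv/= andbT => x0; rewrite lee_fin ltW// decay_gt0.
Qed.

Lemma locally_smooth_continuous (R : realType) (f : R -> R) :
  locally_smooth f -> {within `[0, +oo[, continuous f}.
Proof.
move=> fs; apply/subspace_continuousP => x; rewrite /= in_itv/= andbT => x0.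
have [g gs fg] := fs x x0.
have fx : f x = g x by move/nbhs_singleton: fg; exact.
suff : f @ within `[0, +oo[ (nbhs x) --> g x by rewrite -fx.
move=> A /(smooth_continuous gs) gA.
rewrite nbhs_simpl /= /within/=; apply: filterS2 fg gA => y fgy gy.
by rewrite in_itv/= andbT => y0; rewrite fgy.
Qed.

(** * The order and the heights of the pulses *)

(** The ruler sequence: k + i + 1 is an odd multiple of 2^j for exactly one [i] in
    a period of length 2^(j+1). *)
Lemma ruler_window (j k : nat) :
  exists2 i : nat, (i < 2 ^ j.+1)%N & logn 2 (k + i).+1 = j.
Proof.
set Q := (2 ^ j.+1)%N; have Q0 : (0 < Q)%N by rewrite expn_gt0.
exists ((2 ^ j + (Q - k.+1 %% Q)) %% Q)%N; first exact: ltn_pmod.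
set i := (_ %% Q)%N.
have e : ((k + i).+1 = 2 ^ j %[mod Q])%N.
  rewrite -addSn /i modnDmr addnCA -modnDml -modnDmr.
  rewrite -(modnDml k.+1) subnKC; last by rewrite ltnW// ltn_pmod.
  by rewrite modnn addn0 modn_mod.
have jQ : (2 ^ j < Q)%N by rewrite ltn_exp2l.
have -> : ((k + i).+1 = 2 ^ j * (((k + i).+1 %/ Q) * 2).+1)%N.
  rewrite [LHS](divn_eq _ Q) e modn_small// mulnS addnC; congr addn.
  by rewrite mulnCA /Q expnSr.
rewrite lognM ?expn_gt0// pfactorK// -[RHS]addn0; congr addn.
by rewrite lognE /= dvdn2 /= oddM andbF.
Qed.

Lemma sqr_le_exp2 (k : nat) : (k * k <= 2 ^ k.+1)%N.
Proof.
elim: k => [//|k IH].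
have := ltn_expl k (isT : (1 < 2)%N).
rewrite !expnS in IH *.
by move: (2 ^ k)%N IH => m IH km; nia.
Qed.

(** [M k] is the largest number up to [k] that the bound [H] allows from 2^k on.
    It is 0 as long as [H] is small somewhere further right. *)
Lemma slow_heights (R : realType) (d : R) (H : R -> R) :
  (forall x, 1 <= x -> 0 <= H x) -> H x @[x --> +oo] --> +oo ->
  exists M : nat -> nat,
  [/\ forall k, (M k <= k)%N,
      forall k x, 2 ^+ k <= x -> d * (M k)%:R <= H x
    & forall m, exists K, forall k, (K <= k)%N -> (m <= M k)%N].
Proof.
move=> H0 Hoo.
pose ok k m := `[< forall x, 2 ^+ k <= x -> d * m%:R <= H x >].
pose M k : nat := \max_(m < k.+1 | ok k m) m; exists M; split.
- by move=> k; apply/bigmax_leqP => i _; rewrite -ltnS.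
- move=> k; suff /asboolP : ok k (M k) by [].
  rewrite /M; apply: (big_ind (fun m : nat => ok k m)) => //.
  + apply/asboolP => x kx; rewrite mulr0; apply: H0.
    by rewrite (le_trans _ kx)// exprn_ege1// ler1n.
  + by move=> m n; rewrite /maxn; case: ifP.
- move=> m; move/cvgryPge : Hoo => /(_ (d * m%:R)) [X [Xr HX]].
  have [K XK] := dyadic_bound X; exists (maxn m K) => k.
  rewrite geq_max => /andP[mk Kk].
  rewrite /M; have mk1 : (m < k.+1)%N by rewrite ltnS.
  apply: (@leq_bigmax_cond _ (fun i : 'I_k.+1 => ok k i) (fun i => i : nat) (Ordinal mk1)).
  apply/asboolP => x kx; apply: HX.
  by rewrite (lt_le_trans XK)// (le_trans _ kx)// ler_weXn2l ?ler1n.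
Qed.

(** Over a period of length P the doublings cost at most 2^P and the visit gains
    8^P, hence the factor 4^(-P) over the period. *)
Lemma dyadic_decay (R : realType) (n : nat -> R) (visit : nat -> bool) (K P : nat) :
  (forall k, 0 <= n k) -> (forall k, (K <= k)%N -> n k.+1 <= 2 * n k) ->
  (forall k, exists2 i, (i < P)%N & visit (k + i)%N) ->
  (forall k, (K <= k)%N -> visit k -> n k.+1 <= n k / 8 ^+ P) ->
  exists C, forall k, (K <= k)%N -> n k <= C / 4 ^+ k.
Proof.
move=> n0 n2 win n8.
have P0 : (0 < P)%N by have [i + _] := win 0%N; exact: leq_trans.
have grow k i : (K <= k)%N -> n (k + i)%N <= 2 ^+ i * n k.
  move=> Kk; elim: i => [|i IH]; first by rewrite addn0 expr0 mul1r.
  rewrite addnS (le_trans (n2 _ _))//; first by rewrite (leq_trans Kk)// leq_addr.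
  by rewrite exprS -mulrA ler_pM2l.
have period k : (K <= k)%N -> n (k + P)%N <= n k / 4 ^+ P.
  move=> Kk; have [i iP vi] := win k.
  have Kki : (K <= k + i)%N by rewrite (leq_trans Kk)// leq_addr.
  have -> : (k + P = (k + i).+1 + (P - i.+1))%N by lia.
  rewrite (le_trans (grow _ _ _))//; first by rewrite (leq_trans Kki).
  have h1 := n8 _ Kki vi; have h2 := grow k i Kk.
  have h3 : n (k + i).+1 <= 2 ^+ i * n k / 8 ^+ P.
    by rewrite (le_trans h1)// ler_wpM2r// invr_ge0 exprn_ge0.
  apply: (@le_trans _ _ (2 ^+ (P - i.+1) * (2 ^+ i * n k / 8 ^+ P))).
    by rewrite ler_wpM2l// exprn_ge0.
  have -> : 2 ^+ (P - i.+1) * (2 ^+ i * n k / 8 ^+ P) =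
      2 ^+ (P - i.+1 + i) * (n k / 8 ^+ P) by rewrite exprD; ring.
  have e8 : 8 ^+ P = 4 ^+ P * 2 ^+ P :> R by rewrite -exprMn; congr (_ ^+ _); ring.
  have -> : n k / 4 ^+ P = 2 ^+ P * (n k / 8 ^+ P).
    by rewrite e8; field; rewrite !expf_neq0 ?pnatr_eq0.
  rewrite ler_wpM2r ?divr_ge0 ?exprn_ge0// ler_weXn2l ?ler1n//; lia.
pose a k := 4 ^+ k * n k.
have a0 k : 0 <= a k by rewrite mulr_ge0// exprn_ge0.
have aP k : (K <= k)%N -> a (k + P)%N <= a k.
  move=> Kk; rewrite /a exprD -mulrA ler_pM2l ?exprn_gt0//.
  by rewrite mulrC -ler_pdivlMr ?exprn_gt0// period.
have a8 i : a (K + i)%N <= 8 ^+ i * a K.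
  rewrite /a; have -> : 8 ^+ i * (4 ^+ K * n K) = 4 ^+ (K + i) * (2 ^+ i * n K).
    have -> : 8 ^+ i = 4 ^+ i * 2 ^+ i :> R by rewrite -exprMn; congr (_ ^+ _); ring.
    by rewrite exprD; ring.
  by rewrite ler_pM2l ?exprn_gt0// grow.
exists (8 ^+ P * a K) => k; rewrite ler_pdivlMr ?exprn_gt0// mulrC -/(a k).
elim/ltn_ind: k => k IH Kk; have [kP|Pk] := ltnP k (K + P).
  have -> : k = (K + (k - K))%N by lia.
  rewrite (le_trans (a8 _))// ler_wpM2r// ler_weXn2l ?ler1n//; lia.
have -> : k = (k - P + P)%N by lia.
rewrite (le_trans (aP _ _))//; first lia.
by apply: IH; lia.
Qed.

Lemma gap_below (R : realType) (lam : nat -> R) (j : nat) : injective lam ->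
  exists2 d : R, 0 < d & forall i, (i < j)%N -> d <= `|lam i - lam j|.
Proof.
move=> inj.
suff : forall m, (m <= j)%N -> exists2 d : R, 0 < d &
  forall i, (i < m)%N -> d <= `|lam i - lam j| by apply.
elim=> [|m IH] mj; first by exists 1.
have [d d0 dP] := IH (ltnW mj).
exists (Num.min d `|lam m - lam j|).
  rewrite lt_min d0 normr_gt0 subr_eq0; apply/eqP => /inj e.
  by rewrite e ltnn in mj.
move=> i; rewrite ltnS leq_eqVlt => /predU1P[->|im].
  by rewrite ge_min lexx orbT.
by rewrite ge_min dP.
Qed.

Lemma le_sqrt_of_sqr (R : realType) (a b : R) :
  0 <= a -> a ^+ 2 <= b -> a <= Num.sqrt b.
Proof. by move=> a0 ab; rewrite -(ger0_norm a0) -sqrtr_sqr; apply: ler_wsqrtr. Qed.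

Lemma min_sqrt_cvgy (R : realType) (h : R -> R) : h x @[x --> +oo] --> +oo ->
  Num.min (h x) (Num.sqrt (Num.sqrt (1 + x))) @[x --> +oo] --> +oo.
Proof.
move=> /cvgryPge hoo; apply/cvgryPge => A; near=> x.
rewrite le_min; apply/andP; split; first by near: x; exact: hoo.
have [A0|A0] := leP A 0; first by rewrite (le_trans A0)// sqrtr_ge0.
apply: le_sqrt_of_sqr; first exact: ltW.
apply: le_sqrt_of_sqr; first exact: sqr_ge0.
by rewrite -lerBlDl; near: x; apply: nbhs_pinfty_ge; rewrite num_real.
Unshelve. all: end_near.
Qed.

Lemma height_small (R : realType) (M : nat -> nat) (d : R) : 0 < d ->
  (forall k, (M k <= k)%N) ->
  exists K, forall k, (K <= k)%N -> (M k)%:R / 2 ^+ k <= d.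
Proof.
move=> d0 Mk; exists (Num.truncn (2 / d)).+1 => k Kk.
have k0 : 0 < k%:R :> R by rewrite ltr0n (leq_trans _ Kk).
have dk : 2 <= d * k%:R.
  rewrite mulrC -ler_pdivrMr// ltW// (lt_le_trans (truncnS_gt _))//.
  by rewrite ler_nat.
rewrite ler_pdivrMr ?exprn_gt0//.
rewrite (@le_trans _ _ k%:R) ?ler_nat// -(ler_pM2r k0).
rewrite (@le_trans _ _ (2 * 2 ^+ k))//.
  by rewrite -exprS -natrX -natrM ler_nat sqr_le_exp2.
by rewrite mulrAC ler_wpM2r// exprn_ge0.
Qed.

(** For i < t, the pulse of target t is allowed only if it is weak compared with
    |lam i - lam t|.  The condition is imposed on i < t only, so that it is
    eventually met for each fixed t.  The pairs with i > t are still covered: for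
    a fixed i there are finitely many such t, and the heights tend to 0. *)
Lemma schedule (R : realType) (c : R) (lam : nat -> R) (H : R -> R) :
  0 < c -> injective lam ->
  (forall x, 1 <= x -> 0 <= H x) -> H x @[x --> +oo] --> +oo ->
  exists (t : nat -> nat) (eps : nat -> R),
  [/\ forall k, 0 <= eps k,
      forall k x, 2 ^+ k <= x -> x <= 2 ^+ k.+1 -> eps k * c <= H x / (1 + x),
      forall j k, exists2 i, (i < 2 ^ j.+1)%N & t (k + i)%N = j
    & forall j m, exists K, forall k, (K <= k)%N ->
        (t k = j -> m%:R <= eps k * 2 ^+ k) /\
        (t k <> j -> 0 < `|lam j - lam (t k)| /\
           eps k * c <= `|lam j - lam (t k)| / 8)].
Proof.
move=> c0 inj H0 Hoo.
have [M [Mk MH Moo]] := slow_heights (3 * c) H0 Hoo.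
pose t k := logn 2 k.+1.
pose e k : R := (M k)%:R / 2 ^+ k.
have e0 k : 0 <= e k by rewrite divr_ge0// exprn_ge0.
pose good k := `[< forall i, (i < t k)%N -> e k * c <= `|lam i - lam (t k)| / 8 >].
exists t, (fun k => if good k then e k else 0); split.
- by move=> k; case: ifP.
- move=> k x kx xk.
  have p1 : 1 <= 2 ^+ k :> R by rewrite exprn_ege1// ler1n.
  have x1 : 1 <= x by exact: le_trans kx.
  have xp : 0 < 1 + x by rewrite ltr_wpDr// (le_trans _ x1).
  apply: (@le_trans _ _ (e k * c)).
    by case: ifP => // _; rewrite mul0r mulr_ge0// ltW.
  rewrite ler_pdivlMr//; apply: le_trans (MH k x kx).
  rewrite (@le_trans _ _ (e k * c * (3 * 2 ^+ k)))//.
    rewrite ler_wpM2l ?mulr_ge0 ?(ltW c0)//.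
    by move: xk; rewrite exprS; move: (2 ^+ k) p1 => m p1 xk; lra.
  rewrite le_eqVlt; apply/orP; left; apply/eqP; rewrite /e; field.
  by rewrite expf_neq0 ?pnatr_eq0.
- by move=> j k; have [i iP it] := ruler_window j k; exists i => //; rewrite /t -addnS.
- move=> j m.
  have [d d0 dP] := gap_below j inj.
  have d8 : 0 < d / 8 / c by rewrite !divr_gt0.
  have [K1 K1P] := height_small d8 Mk.
  have [K2 K2P] := Moo m.
  exists (maxn K1 K2) => k; rewrite geq_max => /andP[k1 k2].
  have ec : e k * c <= d / 8 by rewrite -ler_pdivlMr// K1P.
  split=> [tj|tj].
    have -> : good k.
      apply/asboolP => i; rewrite tj => ij.
      by rewrite (le_trans ec)// ler_wpM2r// dP.
    by rewrite /e divfK ?expf_neq0 ?pnatr_eq0// ler_nat K2P.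
  have l0 : 0 < `|lam j - lam (t k)|.
    by rewrite normr_gt0 subr_eq0; apply/eqP => /inj/esym.
  split => //; case: ifPn => [/asboolP gk|_]; last by rewrite mul0r divr_ge0// ltW.
  have [jt|tj'|//] := ltngtP j (t k); first exact: gk.
  by rewrite (le_trans ec)// ler_wpM2r// distrC dP.
  by move=> e'; rewrite e' in tj.
Qed.

Lemma expR_resonant_small (R : realType) (x : R) (P : nat) :
  (8 ^ P)%:R <= x -> expR (- (2 * x)) <= (8 ^+ P)^-1.
Proof.
move=> xP; have p0 : 0 < 8 ^+ P :> R by rewrite exprn_gt0.
rewrite natrX in xP.
rewrite expRN lef_pV2 ?posrE ?expR_gt0//.
have := expR_ge1Dx (2 * x); lra.
Qed.

(** * Back to the Dirac equation *)

(** Real and imaginary parts of exp(- i lam x) (U + i V). *)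
Definition derot_u (R : realType) (lam : R) (U V : R -> R) (x : R) : R :=
  cos (lam * x) * U x + sin (lam * x) * V x.

Definition derot_v (R : realType) (lam : R) (U V : R -> R) (x : R) : R :=
  cos (lam * x) * V x - sin (lam * x) * U x.

Lemma derot_sqmod (R : realType) (lam : R) (U V : R -> R) (x : R) :
  sqmod (derot_u lam U V) (derot_v lam U V) x = sqmod U V x.
Proof.
rewrite /sqmod /derot_u /derot_v.
rewrite -[RHS]mul1r -(cos2Dsin2 (lam * x)); ring.
Qed.

Lemma is_derive_derot (R : realType) (p q : R -> R) (lam : R) (U V : R -> R) (x : R) :
  rot_solution p q lam U V ->
  let u := derot_u lam U V in let v := derot_v lam U V in
  is_derive x 1 u (- q x * u x + (lam - p x) * v x) /\
  is_derive x 1 v (- (lam + p x) * u x + q x * v x).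
Proof.
move=> sol u v; have [dU dV] := sol x.
have dc := is_derive_cos_lin lam x; have ds := is_derive_sin_lin lam x.
have e : 2 * lam * x = lam * x + lam * x by ring.
have ccss := cos2Dsin2 (lam * x).
have c2 (z : R) : z = (cos (lam * x) ^+ 2 + sin (lam * x) ^+ 2) * z by rewrite ccss mul1r.
split.
- apply: is_derive_val (is_deriveDf (is_deriveMf dc dU) (is_deriveMf ds dV)) _.
  rewrite /rot_re /rot_im e cosD sinD /u /v /derot_u /derot_v.
  set C := cos _ in ccss c2 *; set S := sin _ in ccss c2 *.
  rewrite [q x in RHS]c2 [p x in RHS]c2; ring.
- apply: is_derive_val (is_deriveBf (is_deriveMf dc dV) (is_deriveMf ds dU)) _.
  rewrite /rot_re /rot_im e cosD sinD /u /v /derot_u /derot_v.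
  set C := cos _ in ccss c2 *; set S := sin _ in ccss c2 *.
  rewrite [q x in RHS]c2 [p x in RHS]c2; ring.
Qed.

Lemma dirac_solution_derot (R : realType) (p q : R -> R) (lam : R) (U V : R -> R) :
  rot_solution p q lam U V ->
  dirac_solution p q lam (derot_u lam U V) (derot_v lam U V).
Proof.
move=> sol x x0; have [du dv] := is_derive_derot x sol.
have refl (f : R -> R) : \forall y \near x, 0 <= y -> f y = f y.
  by exists 1 => /=.
have [hu u'] := hl_derive_near x0 du (refl _).
have [hv v'] := hl_derive_near x0 dv (refl _).
split => //; rewrite /dirac_op u' v'.
apply/matrixP => i j; rewrite !mxE !big_ord_recl !big_ord0 !mxE/=.
by case: (i == 0) => /=; ring.
Qed.

Lemma derot_continuous (R : realType) (p q : R -> R) (lam : R) (U V : R -> R) :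
  rot_solution p q lam U V ->
  continuous (derot_u lam U V) /\ continuous (derot_v lam U V).
Proof.
move=> sol; split=> x; have [du dv] := is_derive_derot x sol;
  exact: is_derive_continuous.
Qed.

Lemma le_decay (R : realType) (x : R) : 0 <= x -> ((1 + x) ^+ 2)^-1 <= decay x.
Proof.
move=> x0; have x1 : 1 <= 1 + x by rewrite lerDl.
have xp : 0 < 1 + x by exact: lt_le_trans x1.
rewrite lef_pV2 ?posrE ?mulr_gt0 ?sqrtr_gt0 ?exprn_gt0// expr2 ler_pM2l//.
rewrite -(@ler_pXn2r _ 2)// ?nnegrE ?sqrtr_ge0 ?(ltW xp)//.
by rewrite sqr_sqrtr ?(ltW xp)// expr2 ler_peMr// ltW.
Qed.

Lemma decay_nincr (R : realType) (x y : R) : 0 <= x -> x <= y -> decay y <= decay x.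
Proof.
move=> x0 xy; have xp : 0 < 1 + x by rewrite ltr_wpDr.
have yp : 0 < 1 + y by rewrite ltr_wpDr// (le_trans x0).
rewrite lef_pV2 ?posrE ?mulr_gt0 ?sqrtr_gt0//.
apply: ler_pM; rewrite ?sqrtr_ge0 ?(ltW xp) ?lerD2l//.
by apply: ler_wsqrtr; rewrite lerD2l.
Qed.

(** On block k >= K the bound holds with constant 18 = 2 * 9, as
    (1 + x)^2 <= 9 * 4^k; on [0, 2^K] a continuous function is bounded. *)
Lemma decay_of_dyadic (R : realType) (f : R -> R) (K : nat) (C : R) :
  continuous f -> (forall x, 0 <= f x) ->
  (forall k, (K <= k)%N -> f (2 ^+ k) <= C / 4 ^+ k) ->
  (forall k, (K <= k)%N -> forall x, 2 ^+ k <= x -> x <= 2 ^+ k.+1 ->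
    f x <= 2 * f (2 ^+ k)) ->
  exists D, forall x, 0 <= x -> f x <= D * decay x.
Proof.
move=> fc f0 fK f2.
have fc' : {within `[(0 : R), 2 ^+ K], continuous f} by exact: continuous_subspaceT.
have [c _ cP] := EVT_max (exprn_ge0 K (ler0n R 2)) fc'.
have C0 : 0 <= C.
  have := fK K (leqnn _); move/(le_trans (f0 _)).
  by rewrite pmulr_lge0// invr_gt0 exprn_gt0.
have dK : 0 < decay (2 ^+ K : R) by rewrite decay_gt0// exprn_ge0.
exists (f c / decay (2 ^+ K) + 18 * C) => x x0.
have dx := decay_gt0 x0.
rewrite mulrDl.
have h1 : 0 <= f c / decay (2 ^+ K) by rewrite divr_ge0// ltW.
have [xK|Kx] := leP x (2 ^+ K).
  rewrite (@le_trans _ _ (f c / decay (2 ^+ K) * decay x))//; last first.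
    by rewrite lerDl !mulr_ge0// ltW.
  rewrite mulrAC -mulrA (@le_trans _ _ (f c))//; first by apply: cP; rewrite in_itv/= x0.
  rewrite ler_peMr// ler_pdivlMr// mul1r; exact: decay_nincr.
rewrite (@le_trans _ _ (18 * C * decay x))//; last by rewrite lerDr mulr_ge0// ltW.
have [k [kx xk]] : exists k : nat, 2 ^+ k <= x /\ x < 2 ^+ k.+1.
  by apply: dyadic_block; rewrite (le_trans _ (ltW Kx))// exprn_ege1// ler1n.
have Kk : (K <= k)%N.
  by rewrite -ltnS -(@ltr_eXn2l R 2) ?ltr1n// (lt_trans Kx).
rewrite (le_trans (f2 _ Kk x kx (ltW xk)))//.
rewrite (@le_trans _ _ (18 * C * ((1 + x) ^+ 2)^-1))//; last first.
  by rewrite ler_wpM2l ?mulr_ge0// le_decay.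
rewrite (@le_trans _ _ (2 * (C / 4 ^+ k)))//; first by rewrite ler_pM2l// fK.
have x1 : 1 + x <= 3 * 2 ^+ k.
  have p1 : 1 <= 2 ^+ k :> R by rewrite exprn_ege1// ler1n.
  by move: xk; rewrite exprS; move: (2 ^+ k) p1 => m p1 xk; lra.
have -> : 18 * C * ((1 + x) ^+ 2)^-1 = 2 * (C * (9 / (1 + x) ^+ 2)).
  by field; rewrite gt_eqF// ltr_wpDr.
rewrite ler_pM2l// ler_wpM2l//.
rewrite ler_pdivlMr ?exprn_gt0 ?ltr_wpDr// mulrC ler_pdivrMr ?exprn_gt0//.
have -> : 9 * 4 ^+ k = (3 * 2 ^+ k) ^+ 2 :> R.
  rewrite exprMn -exprM mulnC exprM; congr (_ * _ ^+ _); ring.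
by rewrite lerXn2r// nnegrE ?mulr_ge0 ?exprn_ge0// addr_ge0.
Qed.

Lemma hl_L2_of_sqmod (R : realType) (f g : R -> R) (D : R) :
  {within `[0, +oo[, continuous f} -> {within `[0, +oo[, continuous g} ->
  (forall x, 0 <= x -> sqmod f g x <= D * decay x) -> hl_L2 f /\ hl_L2 g.
Proof.
move=> fc gc fgD; split; apply: (@hl_L2_decay _ _ D) => // x /fgD; apply: le_trans.
  by rewrite lerDl sqr_ge0.
by rewrite lerDr sqr_ge0.
Qed.

Theorem theorem1p4 (R : realType) (lambda theta : nat -> R) (h : R -> R)
    (lambda_distinct : injective lambda)
    (theta_range : forall j : nat, 0 <= theta j < pi)
    (h_pos : forall x : R, 0 <= x -> 0 < h x)
    (h_lim : h x @[x --> +oo] --> +oo) :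
  exists p q : R -> R,
    [/\ hl_smooth p, hl_smooth q, hl_L2 p, hl_L2 q
      & (forall x : R, 0 <= x ->
           Num.sqrt (p x ^+ 2 + q x ^+ 2) <= h x / (1 + x)) /\
        (forall j : nat, exists u v : R -> R,
           [/\ dirac_solution p q (lambda j) u v, hl_nontrivial u v,
               hl_L2 u, hl_L2 v & boundary_cond (theta j) u v])].
Proof.
(* The second term of the minimum makes (H x / (1 + x))^2 at most [decay x]. *)
pose H x := Num.min (h x) (Num.sqrt (Num.sqrt (1 + x))).
have H0 x : 0 <= x -> 0 <= H x.
  by move=> x0; rewrite le_min (ltW (h_pos _ x0)) sqrtr_ge0.
have H1 x : 1 <= x -> 0 <= H x by move=> x1; apply: H0; rewrite (le_trans _ x1).
have [c c0 train] := pulse_train R.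
have [t [eps [eps0 epsH win sched]]] :=
  schedule c0 lambda_distinct H1 (min_sqrt_cvgy h_lim).
have [p [q [U [V [[ps qs] pq1 pqB sol rate]]]]] :=
  train lambda t eps (fun j => (cos (theta j), sin (theta j))) eps0.
have pqH x : 0 <= x -> p x ^+ 2 + q x ^+ 2 <= (H x / (1 + x)) ^+ 2.
  move=> x0; have [x1|/ltW x1] := leP x 1.
    by have [-> ->] := pq1 x x1; rewrite expr0n addr0 sqr_ge0.
  have [k [kx xk]] := dyadic_block x1.
  rewrite (le_trans (pqB k x kx (ltW xk)))//.
  rewrite lerXn2r ?nnegrE ?mulr_ge0 ?eps0 ?(ltW c0) ?epsH ?(ltW xk)//.
  - exact: H1.
  - by rewrite invr_ge0 addr_ge0.
have pq_decay x : 0 <= x -> sqmod p q x <= 1 * decay x.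
  move=> x0; rewrite mul1r (le_trans (pqH x x0))//.
  have xp : 0 < 1 + x by rewrite ltr_wpDr.
  have Hs : H x ^+ 2 <= Num.sqrt (1 + x).
    rewrite -[leRHS]sqr_sqrtr ?sqrtr_ge0// lerXn2r ?nnegrE ?sqrtr_ge0 ?H0//.
    by rewrite ge_min lexx orbT.
  rewrite expr_div_n ler_pdivrMr ?exprn_gt0// (le_trans Hs)//.
  have s0 : Num.sqrt (1 + x) != 0 by rewrite gt_eqF// sqrtr_gt0.
  rewrite /decay le_eqVlt; apply/orP; left; apply/eqP.
  move: (sqr_sqrtr (ltW xp)) s0; move: (Num.sqrt (1 + x)) => s <- s0.
  by field.
have [pL qL] := hl_L2_of_sqmod (locally_smooth_continuous ps)
  (locally_smooth_continuous qs) pq_decay.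
exists p, q; split => //; try exact: hl_smoothP; split.
  move=> x x0; have xp : 0 < 1 + x by rewrite ltr_wpDr.
  rewrite (@le_trans _ _ (H x / (1 + x)))//; last first.
    by rewrite ler_wpM2r ?invr_ge0 ?(ltW xp)// /H ge_min lexx.
  rewrite -(@ger0_norm _ (H x / (1 + x))); last by rewrite divr_ge0 ?H0// ltW.
  by rewrite -sqrtr_sqr ler_wsqrtr// pqH.
move=> j; have [solj init] := sol j.
pose u := derot_u (lambda j) (U j) (V j); pose v := derot_v (lambda j) (U j) (V j).
have [uc vc] := derot_continuous solj.
have sqE x : sqmod u v x = sqmod (U j) (V j) x by exact: derot_sqmod.
have u0 : u 0 = cos (theta j).
  have [U0 V0] := init 0 ler01.
  by rewrite /u /derot_u mulr0 cos0 sin0 U0 mul0r addr0 mul1r.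
have v0 : v 0 = sin (theta j).
  have [U0 V0] := init 0 ler01.
  by rewrite /v /derot_v mulr0 cos0 sin0 V0 mul0r subr0 mul1r.
pose P := (2 ^ j.+1)%N.
(* From K on, a visit multiplies the squared modulus by at most
   exp(- 2 * 8^P) <= 8^(-P). *)
have [K KP] := sched j (8 ^ P)%N.
have n0 x : 0 <= sqmod u v x by rewrite addr_ge0// sqr_ge0.
have block k : (K <= k)%N -> forall x, 2 ^+ k <= x -> x <= 2 ^+ k.+1 ->
    sqmod u v x <= 2 * sqmod u v (2 ^+ k).
  move=> Kk x kx xk; have [_ off] := KP k Kk; have [on' off'] := rate k j.
  rewrite !sqE; have [tj|tj] := eqVneq (t k) j.
    have [bd _] := on' (esym tj).
    by rewrite (le_trans (bd _ kx xk))// ler_peMl ?ler1n// -sqE.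
  by have [l0 le] := off (elimN eqP tj); exact: off'.
have [C CP] : exists C, forall k, (K <= k)%N -> sqmod u v (2 ^+ k) <= C / 4 ^+ k.
  apply: (@dyadic_decay R (fun k => sqmod u v (2 ^+ k)) (fun k => t k == j) K P) => //.
  - by move=> k Kk; apply: block => //; rewrite ler_weXn2l ?ler1n.
  - by move=> k; have [i iP ti] := win j k; exists i => //; apply/eqP.
  - move=> k Kk /eqP tj; have [on _] := KP k Kk; have [on' _] := rate k j.
    have [_] := on' (esym tj); rewrite !sqE => /le_trans; apply.
    rewrite ler_wpM2l -?sqE//.
    have -> : 2 * eps k * 2 ^+ k = 2 * (eps k * 2 ^+ k) by rewrite mulrA.
    by apply: expR_resonant_small; exact: on.
have [D DP] : exists D, forall x, 0 <= x -> sqmod u v x <= D * decay x.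
  apply: (decay_of_dyadic _ n0 CP block).
  by move=> x; apply: cvgD; apply: cvgM; [exact: uc|exact: uc|exact: vc|exact: vc].
have [uL vL] := hl_L2_of_sqmod (continuous_subspaceT uc) (continuous_subspaceT vc) DP.
exists u, v; split => //.
- exact: dirac_solution_derot.
- exists 0 => //; apply/eqP => /matrixP e.
  have := cos2Dsin2 (theta j).
  have := e 0 0; have := e 1 0; rewrite !mxE /= u0 v0 => -> ->.
  by rewrite expr0n addr0 => /eqP; rewrite eq_sym oner_eq0.
- by rewrite /boundary_cond u0 v0 mulrC subrr.
Qed.
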